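(* Let $H$ be a forest with connected components the trees $T_1,\dots,T_k$, and let $b$ be a positive integer. Consider $(1:b)$ Client-Waiter vertex games. (1) If $H$ is a tree ($k=1$), there exists a tree $T$ such that Client wins the $(1:b)$ Client-Waiter vertex $H$-game played on $T$. (2) For each $i\in[k]$ let $T^{(i)}_{\min}$ be a tree with the minimum number of vertices such that Client wins the $(1:b)$ Client-Waiter vertex $T_i$-game played on it, and let $T_{\max}$ be one of the trees $T^{(i)}_{\min}$ with the maximum number of vertices; write $v=v(T_{\max})$, $e=e(T_{\max})$. Then for $G\sim G(n,p)$: if $p=\omega(n^{-v/e})$ then w.h.p. Client wins the $(1:b)$ Client-Waiter vertex $H$-game on $G$, and if $p=o(n^{-v/e})$ then w.h.p. Waiter wins it.
   Context: The $(1:b)$ Client-Waiter vertex $H$-game on a graph $G$: in each round Waiter offers a set of $t$ previously unclaimed vertices with $1\le t\le b+1$; Client claims one of them and Waiter claims the rest; in the last round Client claims one of the remaining vertices and Waiter the rest. Client wins if the subgraph of $G$ induced by his vertices contains a (not necessarily induced) copy of $H$; otherwise Waiter wins. $G(n,p)$ is the binomial random graph; ''w.h.p.'' means with probability tending to 1 as $n\to\infty$.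
   Formalization: Part (2) is stated for forests H with at least one edge; for an edgeless H every minimal tree is a single vertex, so e(T_max)=0 and n^{-v/e} is undefined. *)

(* Defs.v *)
From Stdlib Require Import Reals.
From mathcomp Require Import all_boot.
Set Implicit Arguments. Unset Strict Implicit. Unset Printing Implicit Defensive.

Definition simple_graph (V : finType) (e : rel V) : Prop :=
  (forall x y, e x y = e y x) /\ (forall x, e x x = false).

Definition has_cycle (V : finType) (e : rel V) : Prop :=
  exists s : seq V, [/\ uniq s, 3 <= size s & cycle e s].

Definition is_forest (V : finType) (e : rel V) : Prop :=
  simple_graph e /\ ~ has_cycle e.

Definition is_tree (V : finType) (e : rel V) : Prop :=
  is_forest e /\ 0 < #|V| /\ (forall x y, connect e x y).

Definition nedges (V : finType) (e : rel V) : nat :=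
  #|[set p : V * V | e p.1 p.2]| %/ 2.

Definition component (V : finType) (e : rel V) (x : V) : {set V} :=
  [set y | connect e x y].

(* The host graph (VG, eG) restricted to the vertex set C contains a (not
   necessarily induced) copy of the subgraph of (VH, eH) induced on A. *)
Definition has_copy (VH : finType) (eH : rel VH) (A : {set VH})
    (VG : finType) (eG : rel VG) (C : {set VG}) : bool :=
  [exists f : {ffun VH -> VG},
     [forall x in A, f x \in C] &&
     [forall x in A, forall y in A,
        ((f x == f y) ==> (x == y)) && (eH x y ==> eG (f x) (f y))]].

(* (1:b) Client-Waiter vertex game.  State: Client's vertices C, free vertices F.
   While F is nonempty, Waiter offers O ⊆ F with 1 <= |O| <= b+1, Client claims
   one x ∈ O and Waiter claims O \ {x}.  Client wins iff at the end his
   vertices contain a copy of the target.  [fuel] bounds the number of rounds. *)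
Fixpoint cw_client_wins (b : nat) (VH : finType) (eH : rel VH) (A : {set VH})
    (VG : finType) (eG : rel VG) (fuel : nat) (C F : {set VG}) : bool :=
  match fuel with
  | 0 => has_copy eH A eG C
  | fuel'.+1 =>
      if F == set0 then has_copy eH A eG C
      else [forall O : {set VG},
              ((O \subset F) && (0 < #|O| <= b.+1)) ==>
              [exists x in O, cw_client_wins b eH A eG fuel' (x |: C) (F :\: O)]]
  end.

Definition client_wins (b : nat) (VH : finType) (eH : rel VH) (A : {set VH})
    (VG : finType) (eG : rel VG) : bool :=
  cw_client_wins b eH A eG #|VG| set0 setT.

Definition min_winning_tree (b : nat) (VH : finType) (eH : rel VH) (A : {set VH})
    (VT : finType) (eT : rel VT) : Prop :=
  [/\ is_tree eT, client_wins b eH A eT &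
      forall (VT' : finType) (eT' : rel VT'),
        is_tree eT' -> client_wins b eH A eT' -> #|VT| <= #|VT'| ].

Definition epair (n : nat) := {p : 'I_n * 'I_n | (p.1 < p.2)%N}.

Definition gadj (n : nat) (E : {set epair n}) : rel 'I_n :=
  fun i j => [exists u in E,
                (((val u).1 == i) && ((val u).2 == j)) ||
                (((val u).1 == j) && ((val u).2 == i))].

Definition gnp_prob (n : nat) (p : R) (Q : pred {set epair n}) : R :=
  \big[Rplus/R0]_(E : {set epair n} | Q E)
     Rmult (pow p #|E|) (pow (Rminus R1 p) (subn #|[set: epair n]| #|E|)).

Definition whp (Q : forall n : nat, pred {set epair n}) (p : nat -> R) : Prop :=
  Un_cv (fun n => @gnp_prob n (p n) (Q n)) R1.

Definition little_omega (p f : nat -> R) : Prop :=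
  forall M : R, Rlt R0 M ->
    exists N : nat, forall n, (N <= n)%nat -> Rle (Rmult M (f n)) (p n).
Definition little_o (p f : nat -> R) : Prop :=
  forall eps : R, Rlt R0 eps ->
    exists N : nat, forall n, (N <= n)%nat -> Rle (p n) (Rmult eps (f n)).

Definition threshold (v e : nat) : nat -> R :=
  fun n => Rpower (INR n) (Ropp (Rdiv (INR v) (INR e))).

Definition prob_bounds (p : nat -> R) : Prop :=
  forall n, Rle R0 (p n) /\ Rle (p n) R1.

(* Main.v *)
Require Import Defs.
From Stdlib Require Import Reals Classical.
From mathcomp Require Import all_boot all_order all_algebra.
From mathcomp Require Import zify ring.
From mathcomp Require Import Rstruct.
Set Implicit Arguments. Unset Strict Implicit. Unset Printing Implicit Defensive.

(** Part (1).  Build H by adding leaves.  If T works for H - x, with x a leaf, attach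
    many leaves to every vertex of T.  Client always answers inside T when T is
    touched; only boundedly many rounds are spent that way, so he can still claim a
    leaf at every vertex of T, and one of these extends his copy of H - x.

    Part (2), lower side.  If p << n^(-v/(v-1)), a first moment computation shows
    that w.h.p. every component of G(n,p) is a tree with fewer than v vertices.
    Waiter plays the components one by one, and by minimality of v Client gets a copy
    of the critical component of H in none of them.

    Part (2), upper side.  If p >> n^(-v/(v-1)), a second moment computation yields
    any constant number of disjoint copies of every minimal winning tree.  Offers
    may meet several of these boards at once.  Giving weight (b+1)^(number of
    Client's vertices) to a board that Client still wins, an answer in the heaviest
    touched board does not decrease the total weight of one kind of boards; ranking
    the kinds and taking many more boards of each next kind, Client wins on some
    board of every kind. *)

(** * The vertex game with an arbitrary goal for Client, and play on sub-boards *)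

Fixpoint cwg (b : nat) (V : finType) (W : pred {set V}) (fuel : nat)
    (C F : {set V}) : bool :=
  match fuel with
  | 0 => W C
  | fuel'.+1 =>
      if F == set0 then W C
      else [forall O : {set V},
              ((O \subset F) && (0 < #|O| <= b.+1)) ==>
              [exists x in O, cwg b W fuel' (x |: C) (F :\: O)]]
  end.

(* A round uses up a free vertex, so that #|F| is enough fuel. *)
Definition cwin (b : nat) (V : finType) (W : pred {set V}) (C F : {set V}) :=
  cwg b W #|F| C F.

Definition monotone (V : finType) (W : pred {set V}) :=
  forall C C' : {set V}, C \subset C' -> W C -> W C'.

Section Game.
Context {b : nat} {V : finType}.
Implicit Types (W : pred {set V}) (C D F O X : {set V}).

Lemma card_setD_offer F O : O \subset F -> 0 < #|O| -> #|F :\: O| < #|F|.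
Proof. by move=> sOF O0; have := subset_leq_card sOF; rewrite cardsDS //; lia. Qed.

Lemma cwg_fuel W n m C F : #|F| <= n -> #|F| <= m -> cwg b W n C F = cwg b W m C F.
Proof.
elim: n m C F => [|n IH] [|m] C F //=; rewrite ?leqn0 ?cards_eq0.
- by move=> ->.
- by move=> _ ->.
move=> Fn Fm; case: eqP => // _; apply: eq_forallb => O.
case: andP => //= -[sOF /andP[O0 _]]; apply: eq_existsb => x; congr andb.
have := card_setD_offer sOF O0.
by move=> lt; apply: IH; lia.
Qed.

Lemma cwin0 W C : cwin b W C set0 = W C.
Proof. by rewrite /cwin cards0. Qed.

Lemma cwinP W C F : F != set0 ->
  reflect (forall O, O \subset F -> 0 < #|O| <= b.+1 ->
             exists2 x, x \in O & cwin b W (x |: C) (F :\: O))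
          (cwin b W C F).
Proof.
move=> F0; have Fp : #|F|.-1.+1 = #|F| by rewrite prednK // card_gt0.
rewrite /cwin -{1}Fp /= (negPf F0).
have eqf O x : O \subset F -> 0 < #|O| ->
    cwg b W #|F|.-1 (x |: C) (F :\: O) = cwin b W (x |: C) (F :\: O).
  by move=> sOF O0; apply: cwg_fuel => //; have := card_setD_offer sOF O0; lia.
apply: (iffP forallP) => H O.
  move=> sOF O1; have /implyP := H O; rewrite sOF O1 => /(_ isT) /exists_inP[x xO].
  by rewrite eqf //; [exists x | case/andP: O1].
apply/implyP => /andP[sOF O1]; have [x xO xw] := H O sOF O1.
by apply/exists_inP; exists x; rewrite // eqf //; case/andP: O1.
Qed.

(** Client's strategies below are given as invariants of positions that some answer to every offer
    preserves. Offers are nonempty, so induction on the number of free vertices suffices. *)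
Lemma cwin_invariant (P : {set V} -> {set V} -> Prop) W C F :
  (forall C, P C set0 -> W C) ->
  (forall C F O, P C F -> O \subset F -> 0 < #|O| <= b.+1 ->
     exists2 x, x \in O & P (x |: C) (F :\: O)) ->
  P C F -> cwin b W C F.
Proof.
move=> P0 PS; have [n] := ubnP #|F|; elim: n C F => // n IH C F Fn PCF.
have [F0|F0] := eqVneq F set0; first by rewrite F0 cwin0; apply: P0; rewrite -F0.
apply/cwinP => // O sOF O1; have [x xO Px] := PS _ _ _ PCF sOF O1.
exists x => //; apply: IH => //; case/andP: O1 => O0 _.
by have := card_setD_offer sOF O0; lia.
Qed.

Lemma cwin_ex W C F : cwin b W C F -> exists C', W C'.
Proof.
have [n] := ubnP #|F|; elim: n C F => // n IH C F Fn.
have [->|F0] := eqVneq F set0; first by rewrite cwin0; exists C.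
have [y yF] := set0Pn _ F0.
move/cwinP => /(_ F0 [set y]); rewrite sub1set cards1 => /(_ yF isT) [x _].
by apply: IH; have := @card_setD_offer F [set y]; rewrite sub1set cards1 yF; lia.
Qed.

Lemma setIU1_in (D C : {set V}) x : x \in D -> (x |: C) :&: D = x |: (C :&: D).
Proof.
by move=> xD; apply/setP => y; rewrite !inE; case: eqVneq => // ->; rewrite xD.
Qed.

Lemma setIU1_out (D C : {set V}) x : x \notin D -> (x |: C) :&: D = C :&: D.
Proof.
move=> xD; apply/setP => y; rewrite !inE; case: eqVneq => // ->.
by rewrite (negPf xD) !andbF.
Qed.

Lemma setID_restr (D F O : {set V}) : (F :\: O) :&: D = (F :&: D) :\: (O :&: D).
Proof. by apply/setP => y; rewrite !inE; do !case: (y \in _). Qed.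

(** The trace of an offer on [D] is a legal offer in the game restricted to [D], so the restricted
    strategy answers it. *)
Lemma local_reply W D C F O :
  cwin b W (C :&: D) (F :&: D) -> O \subset F -> #|O| <= b.+1 -> O :&: D != set0 ->
  exists2 x, x \in O :&: D & cwin b W ((x |: C) :&: D) ((F :\: O) :&: D).
Proof.
move=> win sOF Ob OD0.
have FD0 : F :&: D != set0.
  by apply: contraNneq OD0 => F0; rewrite -subset0 -F0 setSI.
have /(cwinP _ _ FD0) /(_ (O :&: D)) := win.
case; first exact: setSI.
  rewrite card_gt0 OD0 /=; apply: leq_trans Ob; apply: subset_leq_card.
  exact: subsetIl.
move=> x xOD xw; exists x => //; rewrite setID_restr setIU1_in //.
by case/setIP: xOD.
Qed.

Lemma local_untouched W D C F O x : x \in O -> O :&: D = set0 ->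
  cwin b W ((x |: C) :&: D) ((F :\: O) :&: D) = cwin b W (C :&: D) (F :&: D).
Proof.
move=> xO OD0; rewrite setID_restr OD0 setD0 setIU1_out //.
by apply/negP => xD; move/setP/(_ x): OD0; rewrite !inE xO xD.
Qed.

(** Client answers in [D] whenever [D] is touched and arbitrarily otherwise; by monotonicity his
    vertices outside [D] do no harm. *)
Lemma cwin_superset W D X : monotone W -> D \subset X ->
  cwin b W set0 D -> cwin b W set0 X.
Proof.
move=> mW DX win.
apply: (@cwin_invariant (fun C F => cwin b W (C :&: D) (F :&: D))).
- by move=> C; rewrite set0I cwin0; apply: mW; apply: subsetIl.
- move=> C F O CF sOF /andP[O0 Ob].
  have [OD0|OD0] := eqVneq (O :&: D) set0.
    have [x xO] := card_gt0P O0.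
    by exists x => //; rewrite local_untouched.
  have [x xOD xw] := local_reply CF sOF Ob OD0.
  by exists x => //; case/setIP: xOD.
by rewrite set0I (setIidPr DX).
Qed.


(** Sending a vertex to the unique board containing it reaches every touched board from [O]. *)
Lemma card_touched (J : finType) (B : J -> {set V}) O :
  (forall i j, i != j -> [disjoint B i & B j]) ->
  #|[set j | O :&: B j != set0]| <= #|O|.
Proof.
move=> dB; pose h x := [pick j | x \in B j].
have hE x j : x \in B j -> h x = Some j.
  rewrite /h; case: pickP => [i xi xj|/(_ j) -> //]; congr Some.
  apply/eqP; apply: contraTT xj => /dB /pred0P /(_ x) /=.
  by rewrite xi /= => ->.
apply: leq_trans (leq_imset_card h (mem O)).
have SomeI : injective (@Some J) by move=> ? ? [].
rewrite -(card_imset _ SomeI); apply: subset_leq_card.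
apply/subsetP => _ /imsetP[j + ->]; rewrite inE => /set0Pn[x /setIP[xO xj]].
by apply/imsetP; exists x => //; rewrite (hE _ _ xj).
Qed.

Lemma sum_argmax (J : finType) (w : J -> nat) (T : {set J}) n :
  #|T| <= n -> 0 < \sum_(j in T) w j ->
  exists2 j, j \in T & \sum_(i in T) w i <= n * w j /\ 0 < w j.
Proof.
move=> Tn s0; have [j0 j0T] : exists j, j \in T.
  by apply/set0Pn; apply: contraTneq s0 => ->; rewrite big_set0.
have [j jT jmax] := @arg_maxnP _ j0 (mem T) w j0T.
exists j => //; have le : \sum_(i in T) w i <= n * w j.
  apply: (@leq_trans (#|T| * w j)); last by rewrite leq_mul2r Tn orbT.
  by rewrite -sum_nat_const; apply: leq_sum => i /jmax.
by split=> //; have := leq_trans s0 le; rewrite muln_gt0 => /andP[].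
Qed.

(* Client answers in D whenever D is touched, and otherwise in the touched board
   where he owns most vertices.  A board still won locally weighs
   (b+1)^(number of Client's vertices in it): an answer outside D then never
   decreases the total weight. *)
Lemma cwin_boards (J : finType) (B : J -> {set V}) (W1 : pred {set V})
    (W2 : J -> pred {set V}) D X v :
  monotone W1 -> (forall j, monotone (W2 j)) ->
  (forall i j, i != j -> [disjoint B i & B j]) ->
  (forall j, [disjoint D & B j]) -> (forall j, #|B j| <= v) ->
  D \subset X -> (forall j, B j \subset X) ->
  cwin b W1 set0 D -> (forall j, cwin b (W2 j) set0 (B j)) ->
  b * b.+1 ^ v * #|D| < #|J| ->
  cwin b (fun C => W1 C && [exists j, W2 j C]) set0 X.
Proof.
move=> mW1 mW2 dB dDB Bv DX BX winD winB ltJ.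
pose w C F j := if cwin b (W2 j) (C :&: B j) (F :&: B j) then b.+1 ^ #|C :&: B j| else 0.
have wv C F j : w C F j <= b.+1 ^ v.
  rewrite /w; case: ifP => // _; apply: leq_pexp2l => //.
  by apply: leq_trans (Bv j); apply: subset_leq_card; apply: subsetIr.
(* A round answered in [D] uses up a free vertex of [D] and spoils at most [b] boards, each of
   weight at most [b.+1 ^ v]. The left side reserves this loss for all such rounds to come. *)
pose inv C F := [/\ [disjoint C & F], cwin b W1 (C :&: D) (F :&: D) &
                  b * b.+1 ^ v * #|F :&: D| < \sum_j w C F j].
apply: (@cwin_invariant inv).
- move=> C [_]; rewrite set0I cwin0 cards0 muln0 => W1C sumw.
  rewrite (mW1 _ _ (subsetIl C D)) //=.
  have [j wj] : exists j, 0 < w C set0 j.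
    apply/existsP; apply: contraTT sumw => /existsPn wj0.
    by rewrite big1 // => j _; have := wj0 j; lia.
  apply/existsP; exists j; move: wj; rewrite /w set0I cwin0.
  by case: ifP => // Wj _; apply: mW2 Wj; apply: subsetIl.
- move=> C F O [dCF win sumw] sOF /andP[O0 Ob].
  pose T := [set j | O :&: B j != set0].
  have dCF' x : x \in O -> [disjoint x |: C & F :\: O].
    move=> xO; rewrite -setI_eq0; apply/eqP/setP => y; rewrite !inE.
    case: eqVneq => [->|_] /=; first by rewrite xO.
    have /pred0P /(_ y) /= := dCF.
    by case: (y \in C) => //= ->; rewrite andbF.
  have wT x j : x \in O -> j \notin T -> w (x |: C) (F :\: O) j = w C F j.
    move=> xO; rewrite inE negbK => /eqP OB; rewrite /w local_untouched //.
    rewrite setIU1_out //; apply/negP => xB.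
    by move/setP/(_ x): OB; rewrite !inE xO xB.
  have split_w (f : J -> nat) : \sum_j f j = \sum_(j in T) f j + \sum_(j | j \notin T) f j.
    by rewrite (bigID (mem T)).
  have rest x : x \in O ->
      \sum_(j | j \notin T) w (x |: C) (F :\: O) j = \sum_(j | j \notin T) w C F j.
    by move=> xO; apply: eq_bigr => j; apply: wT.
  have [OD0|OD0] := eqVneq (O :&: D) set0; last first.
    have [x xOD xw] := local_reply win sOF Ob OD0.
    have /setIP[xO xD] := xOD; exists x => //; split=> //; first exact: dCF'.
    (* The answer lies in [D], hence in no board, so only the other vertices of the offer can touch
       boards. *)
    have Tb : #|T| <= b.
      have -> : T = [set j | (O :\ x) :&: B j != set0].
        apply/setP => j; rewrite !inE; congr (_ != _); apply/setP => y; rewrite !inE.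
        case: eqVneq => //= ->; have /pred0P /(_ x) /= := dDB j.
        by rewrite xD /= => ->; rewrite andbF.
      apply: leq_trans (card_touched _ dB) _.
      by move: Ob; rewrite (cardsD1 x) xO.
    have ltD : #|(F :\: O) :&: D| < #|F :&: D|.
      rewrite setID_restr; apply: card_setD_offer; first exact: setSI.
      by rewrite card_gt0.
    rewrite split_w rest //; rewrite split_w in sumw.
    have le1 : \sum_(j in T) w C F j <= b * b.+1 ^ v.
      apply: (@leq_trans (#|T| * b.+1 ^ v)); last by rewrite leq_mul2r Tb orbT.
      by rewrite -sum_nat_const; apply: leq_sum => j _.
    have le2 : b * b.+1 ^ v * #|(F :\: O) :&: D|.+1 <= b * b.+1 ^ v * #|F :&: D|.
      by rewrite leq_mul2l ltD orbT.
    rewrite mulnS in le2; lia.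
  have [sT0|sT] := posnP (\sum_(j in T) w C F j).
    have [x xO] := card_gt0P O0; exists x => //; split; first exact: dCF'.
      by rewrite local_untouched.
    rewrite setID_restr OD0 setD0 split_w rest //.
    by rewrite split_w sT0 in sumw; lia.
  have [j jT [le_sum wj]] := sum_argmax (leq_trans (card_touched O dB) Ob) sT.
  have winj : cwin b (W2 j) (C :&: B j) (F :&: B j) by move: wj; rewrite /w; case: ifP.
  have OB0 : O :&: B j != set0 by move: jT; rewrite inE.
  have [x /setIP[xO xB] xw] := local_reply winj sOF Ob OB0.
  exists x => //; split; [exact: dCF' | by rewrite local_untouched |].
  rewrite setID_restr OD0 setD0 split_w rest //; rewrite split_w in sumw.
  (* The weight of board [j] grows by the factor [b.+1], which makes up for the touched boards:
     there are at most [b.+1], none heavier than [j]. *)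
  have wx : w (x |: C) (F :\: O) j = b.+1 * w C F j.
    rewrite /w xw winj setIU1_in // cardsU1 inE.
    have /pred0P /(_ x) /= := dCF; rewrite (subsetP sOF) // andbT => ->.
    by rewrite expnS.
  apply: leq_trans sumw _; rewrite leq_add2r; apply: leq_trans le_sum _.
  by rewrite -wx (bigD1 j) //= leq_addr.
split.
- by rewrite disjoints_subset sub0set.
- by rewrite set0I (setIidPr DX).
(* Initially Client owns nothing, so each board weighs 1 and the total is [#|J|]. *)
rewrite (setIidPr DX); apply: leq_trans ltJ _.
rewrite -sum1_card; apply: leq_sum => j _.
by rewrite /w set0I (setIidPr (BX j)) winB cards0.
Qed.

End Game.

(** * Transfer along injections, Waiter's play on classes, and boards of many kinds *)

Lemma cwin_reply (b : nat) (V : finType) (W : pred {set V}) (C F O : {set V}) :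
  cwin b W C F -> O \subset F -> 0 < #|O| <= b.+1 ->
  exists2 x, x \in O & cwin b W (x |: C) (F :\: O).
Proof.
move=> win sOF O1; have F0 : F != set0.
  by case/andP: O1 => + _; rewrite card_gt0; apply: contraNneq => F0; rewrite -subset0 -F0.
by move/(cwinP _ _ F0): win; apply.
Qed.

Lemma cwin_sub (b : nat) (V : finType) (W W' : pred {set V}) (C F : {set V}) :
  (forall C, W C -> W' C) -> cwin b W C F -> cwin b W' C F.
Proof.
move=> WW'; apply: (@cwin_invariant b V (cwin b W)); last exact: cwin_reply.
by move=> C0; rewrite cwin0 => /WW'.
Qed.

(** An offer inside [f @: F] is the image of its preimage, so the strategy on [U] answers it. *)
Lemma cwin_image (b : nat) (U V : finType) (f : U -> V) (W : pred {set U})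
    (W' : pred {set V}) (C F : {set U}) : injective f ->
  (forall C : {set U}, W C -> W' (f @: C)) -> cwin b W C F -> cwin b W' (f @: C) (f @: F).
Proof.
move=> injf WW' win.
pose inv (C' F' : {set V}) := exists (C0 F0 : {set U}),
  [/\ C' = f @: C0, F' = f @: F0 & cwin b W C0 F0].
apply: (@cwin_invariant b V inv); last by exists C, F.
  move=> C' [C0 [F0 [-> /esym/eqP]]]; rewrite imset_eq0 => /eqP ->.
  by rewrite cwin0 => /WW'.
move=> C' F' O [C0 [F0 [-> -> win0]]] sOF O1.
have OE : f @: (f @^-1: O) = O.
  apply/setP => y; apply/imsetP/idP => [[x + ->]|yO]; first by rewrite inE.
  have /imsetP[x _ yx] := subsetP sOF y yO.
  by exists x; rewrite // inE -yx.
have [||x] := cwin_reply (O := f @^-1: O) win0.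
- apply/subsetP => x; rewrite inE => /(subsetP sOF) /imsetP[x' x'F /injf ->] //.
- by rewrite -(card_imset _ injf) OE.
rewrite inE => xO winx; exists (f x) => //.
exists (x |: C0), (F0 :\: f @^-1: O); rewrite imsetU1; split=> //.
apply/setP => y; rewrite inE; apply/andP/imsetP => [[yO /imsetP[z zF yz]]|[z]].
  by exists z => //; rewrite !inE -yz yO.
by rewrite !inE => /andP[zO zF] ->; rewrite imset_f.
Qed.

(** Client pushes each offer on [U] forward to [V] and pulls the answer back. *)
Lemma cwin_preimage (b : nat) (U V : finType) (f : U -> V) (W : pred {set U})
    (W' : pred {set V}) (C F : {set U}) : injective f ->
  (forall C : {set U}, W' (f @: C) -> W C) -> cwin b W' (f @: C) (f @: F) -> cwin b W C F.
Proof.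
move=> injf WW'.
apply: (@cwin_invariant b U (fun C F : {set U} => cwin b W' (f @: C) (f @: F))).
  by move=> C0; rewrite imset0 cwin0 => /WW'.
move=> C0 F0 O win0 sOF O1.
have [||_ /imsetP[x xO ->] winx] := cwin_reply (O := f @: O) win0.
- exact: imsetS.
- by rewrite card_imset.
exists x => //; move: winx; rewrite imsetU1.
suff -> : f @: (F0 :\: O) = f @: F0 :\: f @: O by [].
apply/setP => y; rewrite inE; apply/imsetP/andP => [[z]|[yO /imsetP[z zF yz]]].
  by rewrite inE => /andP[zO zF] ->; rewrite mem_imset // zO imset_f.
by exists z; rewrite // inE zF andbT; apply: contraNN yO => zO; rewrite yz imset_f.
Qed.

(* Waiter plays on the classes of r one after the other. *)
Lemma waiter_wins_classes (b : nat) (V K : finType) (r : V -> K) (W : pred {set V}) :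
  (forall C, W C -> exists k, W (C :&: r @^-1: [set k])) ->
  (forall k, ~~ cwin b W set0 (r @^-1: [set k])) -> ~~ cwin b W set0 setT.
Proof.
move=> Wloc lose.
suff gen (C F : {set V}) :
    (forall k, ~~ cwin b W (C :&: r @^-1: [set k]) (F :&: r @^-1: [set k])) ->
    ~~ cwin b W C F.
  by apply: gen => k; rewrite set0I setTI.
have [n] := ubnP #|F|; elim: n C F => // n IH C F Fn loseCF.
have [F0|/set0Pn[y yF]] := eqVneq F set0.
  rewrite F0 cwin0; apply/negP => /Wloc[k]; apply/negP.
  by have := loseCF k; rewrite F0 set0I cwin0.
pose D := r @^-1: [set r y].
have FD0 : F :&: D != set0 by apply/set0Pn; exists y; rewrite !inE yF eqxx.
(* The class of the free vertex [y] has an offer to which every answer loses. It is legal in the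
   whole game and leaves the other classes untouched. *)
have [O [sO O1 loseO]] : exists O : {set V}, [/\ O \subset F :&: D, 0 < #|O| <= b.+1 &
    forall x, x \in O -> ~~ cwin b W (x |: (C :&: D)) ((F :&: D) :\: O)].
  case: (pickP (fun O : {set V} => [&& O \subset F :&: D, 0 < #|O| <= b.+1 &
     [forall x in O, ~~ cwin b W (x |: (C :&: D)) ((F :&: D) :\: O)]])).
    by move=> O /and3P[? ? /forall_inP ?]; exists O.
  move=> none; have /negP[] := loseCF (r y); apply/cwinP => // O sO O1.
  have := none O; rewrite sO O1 /= => /negbT; rewrite negb_forall_in.
  by case/exists_inP => x xO; rewrite negbK; exists x.
have sOF : O \subset F by apply: subset_trans sO (subsetIl _ _).
have sOD : O \subset D by apply: subset_trans sO (subsetIr _ _).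
apply/negP => /cwin_reply /(_ sOF O1) [x xO]; apply/negP; apply: IH.
  by have := @card_setD_offer V F O sOF; case/andP: O1 => O0 _; lia.
move=> k; have [->|kr] := eqVneq k (r y).
  rewrite setID_restr setIU1_in ?(subsetP sOD) // (setIidPl sOD).
  exact: loseO.
rewrite local_untouched //; apply/setP => z; rewrite !inE.
apply/negP => /andP[/(subsetP sOD)]; rewrite !inE => /eqP zy /eqP zk.
by rewrite -zk zy eqxx in kr.
Qed.

(** Induction on the kinds: once kind [k] is secured, [D] and its boards merge into the set to be
    protected for the remaining kinds. [M] is fixed before the host, so that the host can be built
    from it. *)
Lemma cwin_board_types (b : nat) (K : eqType) (ks : seq K) (v d : nat) :
  exists M, forall (V : finType) (D : {set V}) (W1 : pred {set V})
    (B : K -> nat -> {set V}) (W2 : K -> nat -> pred {set V}),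
    uniq ks -> monotone W1 -> (forall k i, monotone (W2 k i)) ->
    (forall k l i j, k \in ks -> l \in ks -> i < M -> j < M -> (k, i) != (l, j) ->
       [disjoint B k i & B l j]) ->
    (forall k i, k \in ks -> i < M ->
       [/\ [disjoint D & B k i], #|B k i| <= v & cwin b (W2 k i) set0 (B k i)]) ->
    #|D| <= d -> cwin b W1 set0 D ->
    cwin b (fun C => W1 C && all (fun k => has (fun i => W2 k i C) (iota 0 M)) ks)
      set0 setT.
Proof.
elim: ks d => [|k ks IH] d.
  exists 0 => V D W1 B W2 _ mW1 _ _ _ _ win.
  by apply: cwin_sub (cwin_superset mW1 (subsetT D) win) => C ->.
pose M1 := (b * b.+1 ^ v * d).+1.
have [M2 HM2] := IH (d + M1 * v); exists (maxn M1 M2).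
move=> V D W1 B W2 /= /andP[kks uks] mW1 mW2 dB HB Dd win.
have le1 (i : 'I_M1) : i < maxn M1 M2 by rewrite leq_max ltn_ord.
have le2 i : i < M2 -> i < maxn M1 M2 by rewrite leq_max => ->; rewrite orbT.
pose D' := D :|: \bigcup_(i < M1) B k i.
pose W1' : pred {set V} := fun C => W1 C && [exists i : 'I_M1, W2 k i C].
have mW1' : monotone W1'.
  move=> C C' CC' /andP[/(mW1 _ _ CC') W1C /existsP[i /(mW2 _ _ _ _ CC') Wi]].
  by rewrite /W1' W1C; apply/existsP; exists i.
have winD' : cwin b W1' set0 D'.
  apply: (@cwin_boards b V 'I_M1 (fun i => B k i) _ (fun i => W2 k i) D _ v) => //.
  - move=> i j ij; apply: dB; rewrite ?mem_head //.
    by apply: contraNneq ij => -[] /val_inj ->.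
  - by move=> i; case: (HB k i) => //; rewrite mem_head.
  - by move=> i; case: (HB k i) => //; rewrite mem_head.
  - exact: subsetUl.
  - by move=> i; apply: subsetU; apply/orP; right; apply: bigcup_sup.
  - by move=> i; case: (HB k i) => //; rewrite mem_head.
  by rewrite card_ord ltnS leq_mul2l Dd orbT.
have D'd : #|D'| <= d + M1 * v.
  apply: leq_trans (leq_card_setU _ _) (leq_add Dd _).
  apply: (@leq_trans (\sum_(i < M1) v)); last by rewrite sum_nat_const card_ord.
  elim/big_rec2: _ => [|i m S _ le]; first by rewrite cards0.
  apply: leq_trans (leq_card_setU _ _) (leq_add _ le).
  by case: (HB k i) => //; rewrite mem_head.
have HB2 l i : l \in ks -> i < M2 ->
    [/\ [disjoint D' & B l i], #|B l i| <= v & cwin b (W2 l i) set0 (B l i)].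
  move=> lks iM; have [|dD Bv winB] := HB l i _ (le2 _ iM).
    by rewrite inE lks orbT.
  split=> //; rewrite -setI_eq0 setIUl setU_eq0 !setI_eq0 dD disjoint_sym /=.
  apply: bigcup_disjoint => j _; rewrite disjoint_sym; apply: dB; rewrite ?inE ?eqxx ?lks ?orbT //.
    exact: le2.
  by apply: contraNneq kks => -[-> _].
apply: cwin_sub (HM2 V D' W1' B W2 uks mW1' mW2 _ HB2 D'd winD') => [C|]; last first.
  move=> l l' i j lks l'ks iM jM; apply: dB; rewrite ?inE ?lks ?l'ks ?orbT //; exact: le2.
move=> /andP[/andP[-> /existsP[i Wi]] /allP allW] /=; apply/andP; split.
  by apply/hasP; exists (val i); rewrite // mem_iota /= add0n.
apply/allP => l /allW /hasP[j]; rewrite mem_iota add0n => /andP[_ jM] Wj.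
by apply/hasP; exists j; rewrite // mem_iota add0n le2.
Qed.

(** * Copies of graphs as goals *)

Lemma client_winsE (b : nat) (VH : finType) (eH : rel VH) (A : {set VH})
    (VG : finType) (eG : rel VG) :
  client_wins b eH A eG = cwin b (has_copy eH A eG) set0 setT.
Proof.
have cwE n C F : cw_client_wins b eH A eG n C F = cwg b (has_copy eH A eG) n C F.
  elim: n C F => //= n IH C F; case: ifP => // _; apply: eq_forallb => O.
  by congr (_ ==> _); apply: eq_existsb => x; rewrite IH.
by rewrite /client_wins /cwin cwE cardsT.
Qed.

Lemma has_copyP (VH : finType) (eH : rel VH) (A : {set VH}) (VG : finType)
    (eG : rel VG) (C : {set VG}) :
  reflect (exists f : VH -> VG, [/\ {in A, forall x, f x \in C},
             {in A &, injective f} &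
             {in A &, forall x y, eH x y -> eG (f x) (f y)}])
          (has_copy eH A eG C).
Proof.
apply: (iffP existsP) => [[f /andP[/forall_inP fC /forall_inP fA]]|[f [fC injf homf]]].
  exists f; split=> // x y xA yA; have /forall_inP /(_ y yA) /andP[] := fA x xA.
    by move=> /implyP inj _ fxy; apply/eqP/inj; rewrite fxy.
  by move=> _ /implyP.
exists (finfun f); apply/andP; split; first by apply/forall_inP => x /fC; rewrite ffunE.
apply/forall_inP => x xA; apply/forall_inP => y yA; rewrite !ffunE.
apply/andP; split; apply/implyP; last exact: homf.
by move=> /eqP /injf ->.
Qed.

Lemma has_copy_mono (VH : finType) (eH : rel VH) (A : {set VH}) (VG : finType)
    (eG : rel VG) : monotone (has_copy eH A eG).
Proof.
move=> C C' CC' /has_copyP[f [fC injf homf]]; apply/has_copyP; exists f; split=> //.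
by move=> x /fC /(subsetP CC').
Qed.

Lemma has_copy_image (VH : finType) (eH : rel VH) (A : {set VH}) (VG VG' : finType)
    (eG : rel VG) (eG' : rel VG') (f : VG -> VG') (C : {set VG}) :
  injective f -> (forall x y, eG x y -> eG' (f x) (f y)) ->
  has_copy eH A eG C -> has_copy eH A eG' (f @: C).
Proof.
move=> injf homf /has_copyP[g [gC injg homg]]; apply/has_copyP; exists (f \o g).
split=> [x /gC gx|x y xA yA /injf /injg -> //|x y xA yA /homg exy].
  exact: imset_f.
by apply: homf; apply: exy.
Qed.

(** * Connected sets grown vertex by vertex, and edge counts in forests *)

(** The nonempty connected sets, with an order of construction. In a forest each new vertex is a
    leaf, so induction over [grown] adds leaves. *)
Inductive grown (V : finType) (e : rel V) : {set V} -> Prop :=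
| grown1 x : grown e [set x]
| grownS S x y of grown e S & x \notin S & y \in S & e x y : grown e (x |: S).

Definition inrel (V : finType) (e : rel V) (S : {set V}) : rel V :=
  fun a c => [&& a \in S, c \in S & e a c].

Lemma grown_nonempty (V : finType) (e : rel V) (S : {set V}) :
  grown e S -> exists x, x \in S.
Proof. by case=> [x|S' x y _ _ _ _]; exists x; rewrite !inE eqxx. Qed.

Lemma grown_connected (V : finType) (e : rel V) (S : {set V}) : simple_graph e ->
  grown e S -> {in S &, forall a c, connect (inrel e S) a c}.
Proof.
move=> [se _]; have symS S' : connect_sym (inrel e S').
  by apply: sym_connect_sym => a c; rewrite /inrel se andbCA.
elim=> [x a c|S' x y _ IH xS yS exy].
  by rewrite !inE => /eqP -> /eqP ->; apply: connect0.
have sub : subrel (connect (inrel e S')) (connect (inrel e (x |: S'))).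
  apply: connect_sub => a c /= /and3P[aS cS eac]; apply: connect1.
  by rewrite /inrel !inE aS cS eac !orbT.
have xc c : c \in S' -> connect (inrel e (x |: S')) x c.
  move=> cS; apply: connect_trans (sub _ _ (IH y c yS cS)).
  by apply: connect1; rewrite /inrel !inE eqxx yS exy orbT.
move=> a c; rewrite !inE => /orP[/eqP->|aS] /orP[/eqP->|cS].
- exact: connect0.
- exact: xc.
- by rewrite symS; apply: xc.
- exact/sub/IH.
Qed.

Lemma path_inrel (V : finType) (e : rel V) (S : {set V}) y p :
  path (inrel e S) y p -> path e y p /\ {subset p <= S}.
Proof.
elim: p y => //= c p IH y /andP[/and3P[_ cS ->] /IH[-> sub]]; split=> // z.
by rewrite inE => /orP[/eqP->|/sub].
Qed.

(** Two different neighbours of [x] in [S] are joined by a path inside [S], which [x] would close to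
    a cycle. *)
Lemma forest_grown_nbr (V : finType) (e : rel V) (S : {set V}) x y z :
  is_forest e -> grown e S -> x \notin S -> y \in S -> z \in S -> e x y -> e x z -> y = z.
Proof.
move=> [sg acyc] gS xS yS zS exy exz; apply/eqP; apply/negP => /negP yz.
have /connectP[p0 pp0 lp0] := grown_connected sg gS yS zS.
case/shortenP: pp0 lp0 => p pp up _ lp.
have [pe sub] := path_inrel pp; apply: acyc; exists (x :: y :: p); split.
- rewrite cons_uniq up andbT; apply: contraNN xS; rewrite inE => /orP[/eqP->//|].
  exact: sub.
- by case: p {pp up pe sub} lp => //= lp; rewrite lp eqxx in yz.
rewrite /= exy rcons_path pe -lp /=; case: sg => se _.
by rewrite se.
Qed.

Lemma connect_crossing (V : finType) (e : rel V) (S : {set V}) y z :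
  connect e y z -> y \in S -> z \notin S -> exists a c, [/\ a \in S, c \notin S & e a c].
Proof.
move=> /connectP[p pp ->]; elim: p y pp => [|c p IH] y /=; first by move=> _ ->.
move=> /andP[eyc pp] yS; have [cS|cS] := boolP (c \in S); first exact: IH.
by move=> _; exists y, c.
Qed.

(** Greedy growth: while the component has a vertex outside [S], some edge leaves [S] and its far
    end can be added. *)
Lemma grown_in_component (V : finType) (e : rel V) x k : simple_graph e ->
  0 < k <= #|component e x| ->
  exists S : {set V}, [/\ grown e S, S \subset component e x & #|S| = k].
Proof.
move=> [se _]; have symc : connect_sym e by apply: sym_connect_sym.
elim: k => // -[_ _|k IH].
  exists [set x]; split; [exact: grown1| |by rewrite cards1].
  by rewrite sub1set inE connect0.
move=> /= lt; have [|S [gS sS cS]] := IH; first by rewrite /= ltnW.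
have [z zx zS] : exists2 z, z \in component e x & z \notin S.
  apply/subsetPn; apply: contraTN lt => /subset_leq_card; rewrite cS; lia.
have [y yS] := grown_nonempty gS.
have cyz : connect e y z.
  have := subsetP sS y yS; rewrite inE symc => /connect_trans; apply.
  by move: zx; rewrite inE.
have [a [c [aS ncS eac]]] := connect_crossing cyz yS zS.
exists (c |: S); split; last by rewrite cardsU1 ncS cS.
  by apply: grownS gS ncS aS _; rewrite se.
rewrite subUset sS andbT sub1set inE.
have := subsetP sS a aS; rewrite inE => /connect_trans; apply.
exact: connect1.
Qed.

Lemma component_grown (V : finType) (e : rel V) x :
  simple_graph e -> grown e (component e x).
Proof.
move=> sg; have [|S [gS sS cS]] := @grown_in_component V e x #|component e x| sg.
  rewrite leqnn andbT; apply/card_gt0P; exists x.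
  by rewrite inE connect0.
by have /eqP <- : S == component e x by rewrite eqEcard sS cS leqnn.
Qed.

Lemma tree_grown (V : finType) (e : rel V) : is_tree e -> grown e setT.
Proof.
move=> [[sg _] [/card_gt0P[x _] conn]].
suff <- : component e x = setT by apply: component_grown.
by apply/setP => y; rewrite !inE conn.
Qed.

(* Twice the number of edges inside S. *)
Definition ep (V : finType) (e : rel V) (S : {set V}) : nat :=
  \sum_(a in S) \sum_(c in S) e a c.

Lemma epU1 (V : finType) (e : rel V) (S : {set V}) x : simple_graph e -> x \notin S ->
  ep e (x |: S) = ep e S + 2 * \sum_(c in S) e x c.
Proof.
move=> [se ie] xS; rewrite /ep big_setU1 //= big_setU1 //= ie add0n.
have -> : \sum_(a in S) \sum_(c in x |: S) e a c =
    \sum_(a in S) (e x a + \sum_(c in S) e a c).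
  by apply: eq_bigr => a aS; rewrite big_setU1 //= se.
by rewrite big_split /=; lia.
Qed.

Lemma ep0 (V : finType) (e : rel V) : ep e set0 = 0.
Proof. by rewrite /ep big_set0. Qed.

Lemma ep_grown (V : finType) (e : rel V) (S : {set V}) : simple_graph e ->
  grown e S -> 2 * #|S| <= ep e S + 2.
Proof.
move=> sg; elim=> [x|S' x y _ IH xS yS exy]; first by rewrite cards1 leq_addl.
rewrite epU1 // cardsU1 xS (bigD1 y) //= exy; lia.
Qed.

(** Restricted to [S'], the construction of [S] adds each vertex with at most one edge, and the
    first one with none. [S'] need not be connected. *)
Lemma ep_forest (V : finType) (e : rel V) (S S' : {set V}) : is_forest e ->
  grown e S -> S' \subset S -> S' != set0 -> ep e S' + 2 <= 2 * #|S'|.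
Proof.
move=> fe; have sg := fe.1; have ep1 x : ep e [set x] = 0.
  by rewrite /ep !big_set1; case: sg => _ ->.
move=> gS; elim: gS S' => [x|S0 x y gS IH xS yS exy] S'.
  by rewrite subset1 => /orP[/eqP->|->//]; rewrite ep1 cards1.
move=> sub S'0; have [xS'|xS'] := boolP (x \in S'); last first.
  apply: IH => //; apply/subsetP => z zS'; have := subsetP sub z zS'.
  by rewrite !inE => /orP[/eqP zx|//]; rewrite -zx zS' in xS'.
have sub' : S' :\ x \subset S0 by rewrite subDset.
have xS'' : x \notin S' :\ x by rewrite !inE eqxx.
rewrite -(setD1K xS') epU1 // cardsU1 xS''.
have [->|ne] := eqVneq (S' :\ x) set0; first by rewrite ep0 big_set0 cards0.
have := IH _ sub' ne.
suff : \sum_(c in S' :\ x) e x c <= 1 by lia.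
have [yS'|yS'] := boolP (y \in S' :\ x).
  rewrite (bigD1 y) //= big1 ?addn0 ?leq_b1 // => c /andP[cS' cy].
  apply/eqP; rewrite eqb0; apply: contraNN cy => exc; apply/eqP.
  exact: (forest_grown_nbr fe gS xS (subsetP sub' _ cS') yS exc exy).
rewrite big1 // => c cS'; apply/eqP; rewrite eqb0; apply: contraNN yS' => exc.
by rewrite -(forest_grown_nbr fe gS xS (subsetP sub' _ cS') yS exc exy).
Qed.

Lemma nedges_tree (V : finType) (e : rel V) : is_tree e -> (nedges e).+1 = #|V|.
Proof.
move=> te; have gT := tree_grown te; have fe := te.1; have [V0 _] := te.2.
have -> : nedges e = ep e setT %/ 2.
  rewrite /nedges -sum1_card /ep pair_big /=; congr (_ %/ _).
  rewrite [RHS](bigID (fun p => e p.1 p.2)) /= [X in _ = _ + X]big1 ?addn0.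
    by apply: eq_big => p; rewrite !inE // => ->.
  by move=> p; rewrite !inE => /negPf ->.
have lo := ep_grown fe.1 gT.
have hi : ep e setT + 2 <= 2 * #|[set: V]|.
  by apply: ep_forest fe gT _ _ => //; rewrite -cards_eq0 cardsT; lia.
rewrite cardsT in lo hi; lia.
Qed.

(** Rotate the cycle to start at [x]: its successor and the last vertex are neighbours of [x], and
    they differ because the length is at least 3. *)
Lemma cycle_two_nbrs (V : finType) (e : rel V) (s : seq V) x :
  cycle e s -> uniq s -> 3 <= size s -> x \in s ->
  exists y z, [/\ y \in s, z \in s, y != z, e x y & e z x].
Proof.
move=> cs us ss /rot_to[i s' E].
have mem_s y : (y \in s) = (y \in x :: s') by rewrite -E mem_rot.
move: cs us ss; rewrite -(rot_cycle i) -(rot_uniq i) -(size_rot i) E.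
case: s' E mem_s => [|y [|c t]] // E mem_s.
rewrite /= rcons_path => /and3P[exy eyc /andP[_ ez]] /and4P[_ yN _ _] _.
exists y, (last c t); split=> //.
- by rewrite mem_s !inE eqxx orbT.
- by rewrite mem_s inE [_ \in y :: _]inE mem_last !orbT.
- by apply: contraNneq yN => ->; apply: mem_last.
Qed.

(** * Winning trees by attaching leaves *)

Definition leaf_rel (V : finType) (e : rel V) (M : nat) : rel (V + V * 'I_M) :=
  fun u w => match u, w with
             | inl a, inl c => e a c
             | inl a, inr l => a == l.1
             | inr l, inl a => a == l.1
             | inr _, inr _ => false
             end.
Arguments leaf_rel {V} e M.

(** A new leaf has a single neighbour and so lies on no cycle; any cycle would already live in
    [e]. *)
Lemma leaf_rel_tree (V : finType) (e : rel V) (M : nat) :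
  is_tree e -> is_tree (leaf_rel e M).
Proof.
move=> [[[se ie] acyc] [V0 conn]].
have sl : forall u w, leaf_rel e M u w = leaf_rel e M w u by case=> [a|a] [c|c] //=.
split; first split.
- by split=> // -[a|a] /=.
- move=> [s [us ss cs]]; apply: acyc.
  have allinl u : u \in s -> exists a, u = inl a.
    case: u => [a|l] us'; first by exists a.
    have [y [z [_ _ yz exy ezx]]] := cycle_two_nbrs cs us ss us'.
    move: exy ezx yz; case: y => [y|y] //=; case: z => [z|z] //= /eqP -> /eqP ->.
    by rewrite eqxx.
  have [s' E] : exists s', s = map inl s'.
    elim: s {us ss cs} allinl => [|u s IH] all; first by exists [::].
    have [|s' ->] := IH; first by move=> w ws; apply: all; rewrite inE ws orbT.
    by have [a ->] := all u (mem_head _ _); exists (a :: s').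
  exists s'; move: us ss cs; rewrite E size_map map_inj_uniq; last by move=> ? ? [].
  by rewrite cycle_map; split.
split.
  by rewrite card_sum; lia.
have symc : connect_sym (leaf_rel e M) by apply: sym_connect_sym.
have conl a c : connect (leaf_rel e M) (inl a) (inl c).
  have /connectP[p pp ->] := conn a c.
  apply/connectP; exists (map inl p); last by rewrite last_map.
  by rewrite path_map.
have conb u : exists a, connect (leaf_rel e M) u (inl a).
  case: u => [a|l]; first by exists a; apply: connect0.
  by exists l.1; apply: connect1 => /=.
move=> u w; have [a ua] := conb u; have [c wc] := conb w.
by apply: connect_trans ua (connect_trans (conl a c) _); rewrite symc.
Qed.

Lemma cwin_singleton (b : nat) (V : finType) (x : V) :
  cwin b (fun C => x \in C) set0 [set x].
Proof.
apply: (@cwin_invariant b V (fun C F => (F \subset [set x]) /\ (x \in C :|: F))).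
- by move=> C [_]; rewrite setU0.
- move=> C F O [Fx _] sOF /andP[/card_gt0P[y yO] _].
  have yx : y = x by have := subsetP Fx y (subsetP sOF y yO); rewrite inE => /eqP.
  exists y => //; rewrite yx !inE eqxx; split=> //.
  exact: subset_trans (subsetDl _ _) Fx.
- by rewrite set0U inE eqxx.
Qed.

(** Send [x] to a claimed leaf at the image of [y]. This is injective since the old copy uses no
    leaves, and a homomorphism since [y] is the only neighbour of [x] in [S]. *)
Lemma has_copy_leaf (VH : finType) (eH : rel VH) (S : {set VH}) x y
    (V : finType) (e : rel V) (M : nat) (C : {set V + V * 'I_M}) :
  is_forest eH -> grown eH S -> x \notin S -> y \in S -> eH x y ->
  has_copy eH S (leaf_rel e M) (C :&: inl @: [set: V]) ->
  (forall a, exists i, inr (a, i) \in C) ->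
  has_copy eH (x |: S) (leaf_rel e M) C.
Proof.
move=> fH gS xS yS exy /has_copyP[f [fC injf homf]] leaf.
have finl z : z \in S -> f z \in C /\ exists a, f z = inl a.
  by move=> /fC /setIP[fzC /imsetP[a _ fza]]; split=> //; exists a.
have [_ [a fya]] := finl y yS; have [i iC] := leaf a.
pose g z := if z == x then inr (a, i) else f z.
have gx : g x = inr (a, i) by rewrite /g eqxx.
have gS' z : z \in S -> g z = f z.
  by move=> zS; rewrite /g; case: eqP => // zx; rewrite -zx zS in xS.
have inlg z : z \in S -> g z <> inr (a, i).
  by move=> zS; rewrite gS' //; have [_ [c ->]] := finl z zS.
have [[se ie] _] := fH.
have nbr z : z \in S -> eH x z -> z = y.
  by move=> zS exz; apply: (forest_grown_nbr fH gS xS zS yS exz exy).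
apply/has_copyP; exists g; split.
- move=> z; rewrite !inE => /orP[/eqP->|zS]; first by rewrite gx.
  by rewrite gS' //; case: (finl z zS).
- move=> z w; rewrite !inE => /orP[/eqP->|zS] /orP[/eqP->|wS] //.
  + by rewrite gx => /esym /inlg; move/(_ wS).
  + by rewrite gx => /inlg; move/(_ zS).
  + by rewrite !gS' //; apply: injf.
- move=> z w; rewrite !inE => /orP[/eqP->|zS] /orP[/eqP->|wS].
  + by rewrite ie.
  + by move=> /(nbr _ wS) ->; rewrite gx gS' // fya /= eqxx.
  + by rewrite se => /(nbr _ zS) ->; rewrite gx gS' // fya /= eqxx.
  + by rewrite !gS' //; apply: homf.
Qed.

Lemma grown_winning_tree (b : nat) (VH : finType) (eH : rel VH) (A : {set VH}) :
  is_forest eH -> grown eH A ->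
  exists (VT : finType) (eT : rel VT), is_tree eT /\ client_wins b eH A eT.
Proof.
move=> fH; elim=> [x|S x y gS [VT [eT [tT winT]]] xS yS exy].
  exists unit, (fun _ _ => false); split.
    split; last by split; [rewrite card_unit | case=> -[]; apply: connect0].
    by split=> [|[[|u [|w s]] [_]]].
  rewrite client_winsE; have -> : [set: unit] = [set tt].
    by apply/setP => -[]; rewrite !inE.
  apply: cwin_sub (cwin_singleton b tt) => C ttC; apply/has_copyP.
  exists (fun=> tt); split=> // [z w|z w]; rewrite !inE => /eqP -> /eqP -> //.
  by case: fH => -[_ ->].
(* The kinds are the vertices of the old tree, the boards of a kind are the single leaves at that
   vertex, and the protected set is the old tree. *)
have [M HM] := cwin_board_types b (enum VT) 1 #|VT|.
(* One leaf more than the [M] boards, because [inord] needs a nonempty index type. *)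
exists ((VT + VT * 'I_M.+1)%type), (leaf_rel eT M.+1).
split; first exact: leaf_rel_tree.
pose D : {set VT + VT * 'I_M.+1} := inl @: [set: VT].
pose W1 (C : {set VT + VT * 'I_M.+1}) := has_copy eH S (leaf_rel eT M.+1) (C :&: D).
pose B (a : VT) (i : nat) : {set VT + VT * 'I_M.+1} := [set inr (a, inord i)].
pose W2 (a : VT) (i : nat) (C : {set VT + VT * 'I_M.+1}) := inr (a, inord i) \in C.
have inl_inj : injective (@inl VT (VT * 'I_M.+1)) by move=> ? ? [].
rewrite client_winsE.
apply: cwin_sub (HM _ D W1 B W2 _ _ _ _ _ _ _).
- move=> C /andP[W1C /allP leaves]; apply: has_copy_leaf fH gS xS yS exy W1C _ => a.
  by have /hasP[i _ iC] := leaves a (mem_enum _ _); exists (inord i).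
- exact: enum_uniq.
- by move=> C C' CC'; apply: has_copy_mono; apply: setSI.
- by move=> a i C C' /subsetP CC' /CC'.
- move=> a c i j _ _ iM jM ne; rewrite disjoints1 inE; apply: contraNneq ne => -[-> /(congr1 val)].
  by rewrite /= !inordK ?ltnS ?(ltnW iM) ?(ltnW jM) // => ->.
- move=> a i _ _; split; last exact: cwin_singleton.
    by rewrite disjoint_sym disjoints1; apply/imsetP => -[].
  by rewrite cards1.
- by rewrite card_imset // cardsT.
rewrite client_winsE in winT; rewrite -(imset0 inl).
apply: (cwin_image (W := has_copy eH S eT)) => // C.
rewrite /W1 => /(has_copy_image (f := inl) (eG' := leaf_rel eT M.+1) inl_inj) H.
by rewrite (setIidPl _) ?H // imsetS ?subsetT.
Qed.

(** * Waiter's win on sparse graphs *)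

Lemma ep_cycle (V : finType) (e : rel V) (s : seq V) : simple_graph e ->
  cycle e s -> uniq s -> 3 <= size s -> 2 * size s <= ep e [set z in s].
Proof.
move=> [se _] cs us ss; have -> : size s = #|[set z in s]|.
  by rewrite cardsE (card_uniqP us).
rewrite mulnC -sum_nat_const; apply: leq_sum => x; rewrite inE => xs.
have [y [z [ys zs yz exy ezx]]] := cycle_two_nbrs cs us ss xs.
rewrite (bigD1 y) ?inE //= (bigD1 z) ?inE ?zs 1?eq_sym //=.
by rewrite exy se ezx.
Qed.

(** Connectivity inside the subtype: an edge of [e] leaving the set reached from [a] would have its
    far end in the component too, hence in that set. *)
Lemma component_subtree (V : finType) (e : rel V) y :
  simple_graph e ->
  (forall s : seq V, [/\ uniq s, 3 <= size s & cycle e s] ->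
     {subset s <= component e y} -> False) ->
  is_tree (fun a c : {z | z \in component e y} => e (val a) (val c)).
Proof.
move=> sg acyc; have [se ie] := sg; pose U := ({z | z \in component e y} : finType).
have valI : injective (val : U -> V) := val_inj.
split; first split.
- by split=> *; [apply: se | apply: ie].
- move=> [s [us ss cs]]; apply: (acyc (map val s)).
    by rewrite map_inj_uniq // size_map cycle_map; split.
  by move=> _ /mapP[u _ ->]; apply: (valP u).
have yU : y \in component e y by rewrite inE connect0.
split; first by apply/card_gt0P; exists (Sub y yU).
move=> a c; apply/negPn/negP => nac.
set eU := fun a c : U => e (val a) (val c) in nac *.
pose S := val @: [set u : U | connect eU a u].
have cac : connect e (val a) (val c).
  have symc : connect_sym e by apply: sym_connect_sym.
  have := valP a; have := valP c; rewrite !inE => yc; rewrite symc => ay.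
  exact: connect_trans ay yc.
have [||d [g [/imsetP[u uS ->] gS eug]]] := connect_crossing (S := S) cac.
- by apply: imset_f; rewrite inE connect0.
- by rewrite mem_imset // inE.
have gU : g \in component e y.
  by have := valP u; rewrite !inE => /connect_trans; apply; apply: connect1.
move/negP: gS; apply; apply/imsetP; exists (Sub g gU); last by rewrite SubK.
rewrite inE; move: uS; rewrite inE => /connect_trans; apply; apply: connect1.
by rewrite /eU SubK.
Qed.

(** The copied graph is connected, so its image stays in one component; this makes the goal local to
    the classes on which Waiter plays. *)
Lemma copy_in_class (VH : finType) (eH : rel VH) x (V : finType) (e : rel V)
    (C : {set V}) : connect_sym e ->
  has_copy eH (component eH x) e C ->
  exists k, has_copy eH (component eH x) e (C :&: fingraph.root e @^-1: [set k]).
Proof.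
move=> symc /has_copyP[f [fC injf homf]]; exists (fingraph.root e (f x)).
apply/has_copyP; exists f; split=> // z zx; rewrite inE fC //= !inE.
rewrite (root_connect symc) symc; apply/negPn/negP => nc.
pose S := [set w in component eH x | connect e (f x) (f w)].
have xz : connect eH x z by move: zx; rewrite inE.
have [||a [c [+ cS eac]]] := connect_crossing (S := S) xz.
- by rewrite !inE !connect0.
- by rewrite inE (negPf nc) andbF.
rewrite inE => /andP[ax fxa].
have cx : c \in component eH x.
  by move: (ax); rewrite !inE => /connect_trans; apply; apply: connect1.
move/negP: cS; apply; rewrite inE cx; apply: connect_trans fxa (connect1 _).
exact: homf.
Qed.

(** A component with at least [v] vertices would contain a connected [v]-set, with at least [v - 1]
    edges; a cycle in a smaller one would span as many edges as vertices. So all components are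
    trees below the minimum size [v]. *)
Lemma waiter_wins_sparse (b : nat) (VH : finType) (eH : rel VH) x (v : nat)
    (V : finType) (e : rel V) :
  (forall (VT : finType) (eT : rel VT), is_tree eT ->
     client_wins b eH (component eH x) eT -> v <= #|VT|) ->
  0 < v -> simple_graph e ->
  (forall S : {set V}, 0 < #|S| < v -> ep e S < 2 * #|S|) ->
  (forall S : {set V}, #|S| = v -> ep e S + 2 < 2 * #|S|) ->
  ~~ client_wins b eH setT e.
Proof.
move=> minv v0 sg small large; have symc : connect_sym e.
  by apply: sym_connect_sym; case: sg.
rewrite client_winsE.
(* A copy of [H] contains one of the component of [x], so preventing the latter is enough. *)
apply: (@contraNN _ (cwin b (has_copy eH (component eH x) e) set0 setT)).
  apply: cwin_sub => C /has_copyP[f [fC injf homf]]; apply/has_copyP; exists f.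
  by split=> [z _|z w _ _|z w _ _]; [apply: fC|apply: injf|apply: homf].
apply: (waiter_wins_classes (r := fingraph.root e)) => [C|k]; first exact: copy_in_class.
(* A vertex that is not a root has an empty class. *)
have [->|/set0Pn[y]] := eqVneq (fingraph.root e @^-1: [set k]) set0.
  rewrite cwin0; apply/negP => /has_copyP[f [fC _ _]].
  by have := fC x; rewrite !inE connect0 => /(_ isT).
rewrite !inE => /eqP yk; have -> : fingraph.root e @^-1: [set k] = component e y.
  by apply/setP => z; rewrite !inE -yk root_connect // symc.
have cv : #|component e y| < v.
  rewrite ltnNge; apply/negP => le.
  have [|S [gS _ cS]] := @grown_in_component V e y v sg; first by rewrite v0.
  by have := ep_grown sg gS; have := large S cS; lia.
have tU : is_tree (fun a c : {z | z \in component e y} => e (val a) (val c)).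
  apply: component_subtree => // s [us ss cs] sub.
  have := ep_cycle sg cs us ss.
  have sE : #|[set z in s]| = size s by rewrite cardsE; apply/card_uniqP.
  have := small [set z in s]; rewrite sE.
  suff : size s <= #|component e y| by lia.
  by rewrite -sE; apply: subset_leq_card; apply/subsetP => z; rewrite inE => /sub.
apply/negP => win; have := minv _ _ tU; rewrite card_sig; rewrite leqNgt cv.
suff -> : client_wins b eH (component eH x)
  (fun a c : {z | z \in component e y} => e (val a) (val c)) by move/(_ isT).
rewrite client_winsE.
apply: (cwin_preimage (f := val) (W' := has_copy eH (component eH x) e) val_inj).
  move=> C /has_copyP[f [fC injf homf]].
  have yU : y \in component e y by rewrite inE connect0.
  pose g z : {z | z \in component e y} := insubd (Sub y yU) (f z).
  have gE z : z \in component eH x -> val (g z) = f z.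
    move=> /fC /imsetP[u _ fu]; rewrite /g val_insubd fu.
    by rewrite (valP u).
  apply/has_copyP; exists g; split.
  - by move=> z zx; rewrite -(mem_imset _ _ val_inj) gE // fC.
  - by move=> z w zx wx gzw; apply: injf => //; rewrite -!gE // gzw.
  - by move=> z w zx wx ezw; rewrite !gE //; apply: homf.
suff -> : [set val u | u in [set: {z | z \in component e y}]] = component e y.
  by rewrite imset0.
apply/setP => z; apply/imsetP/idP => [[u _ ->]|zy]; first exact: (valP u).
by exists (Sub z zy); rewrite ?SubK ?inE.
Qed.

(** * Boards of a common size and their disjoint union *)

Lemma sum_support (I : finType) (A S : {set I}) (F : I -> nat) : A \subset S ->
  (forall i, i \in S -> i \notin A -> F i = 0) -> \sum_(i in S) F i = \sum_(i in A) F i.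
Proof.
move=> AS F0; rewrite (big_setID A) /= (setIidPr AS) [X in _ + X]big1 ?addn0 //.
by move=> i; rewrite inE => /andP[iA iS]; apply: F0.
Qed.

(** The winning tree is padded with isolated vertices to exactly [v] vertices, so that all
    components of [H] get boards of one type. Padding keeps both the edge bound and Client's win. *)
Lemma winning_board (b : nat) (VH : finType) (eH : rel VH) (A : {set VH})
    (VT : finType) (eT : rel VT) (v : nat) :
  is_tree eT -> client_wins b eH A eT -> #|VT| <= v ->
  exists e : rel 'I_v, [/\ simple_graph e,
    forall S : {set 'I_v}, S != set0 -> ep e S + 2 <= 2 * #|S| &
    cwin b (has_copy eH A e) set0 setT].
Proof.
move=> tT winT Tv; have fT := tT.1; have [[se ie] _] := fT.
pose h (a : VT) : 'I_v := widen_ord Tv (enum_rank a).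
have hI : injective h by move=> a c /(congr1 val) /= /val_inj /enum_rank_inj.
pose e : rel 'I_v := fun i j => [exists a, exists c, [&& h a == i, h c == j & eT a c]].
have eE a c : e (h a) (h c) = eT a c.
  apply/existsP/idP => [[a' /existsP[c' /and3P[/eqP/hI-> /eqP/hI-> //]]]|eac].
  by exists a; apply/existsP; exists c; rewrite !eqxx.
have eP i j : e i j -> exists a c, [/\ i = h a, j = h c & eT a c].
  by move=> /existsP[a /existsP[c /and3P[/eqP<- /eqP<- ?]]]; exists a, c.
have esym i j : e i j = e j i.
  by apply/idP/idP => E; have [a [c [-> -> eac]]] := eP _ _ E; rewrite eE se.
exists e; split.
- split=> // i; case E : (e i i) => //.
  by have [a [c [-> /hI <-]]] := eP _ _ E; rewrite ie.
- move=> S S0; pose S' := h @^-1: S.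
  have sub : h @: S' \subset S by apply/subsetP => _ /imsetP[a + ->]; rewrite inE.
  have -> : ep e S = ep eT S'.
    have out i j : i \in S -> i \notin h @: S' -> e i j = false.
      move=> iS iS'; case E : (e i j) => //; have [a [c [ia _ _]]] := eP _ _ E.
      rewrite ia in iS iS'.
      by case/negP: iS'; apply: imset_f; rewrite inE.
    have injS : {in S' &, injective h} by move=> ? ? _ _ /hI.
    rewrite /ep (sum_support sub) => [|i iS iS']; last first.
      by rewrite big1 // => j _; rewrite out.
    rewrite big_imset //=; apply: eq_bigr => a _.
    rewrite (sum_support sub) => [|i iS iS']; last by rewrite esym out.
    by rewrite big_imset //=; apply: eq_bigr => c _; rewrite eE.
  have [->|S'0] := eqVneq S' set0.
    by rewrite ep0; move: S0; rewrite -card_gt0; lia.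
  have := ep_forest fT (tree_grown tT) (subsetT S') S'0.
  have : #|S'| <= #|S| by rewrite -(card_imset _ hI) subset_leq_card.
  lia.
apply: (cwin_superset (D := h @: setT)) => //.
  exact: has_copy_mono.
rewrite client_winsE in winT; rewrite -(imset0 h).
apply: (cwin_image (W := has_copy eH A eT)) => // C.
by apply: has_copy_image => // a c; rewrite eE.
Qed.

(** The disjoint union of the graphs [e k]. *)
Definition block_rel (K U : finType) (e : K -> rel U) : rel (K * U) :=
  fun a c => (a.1 == c.1) && e a.1 a.2 c.2.

(** If [S] meets a block in x vertices, 0 < x <= v, these span at most x - 1 edges, and v(x - 1) <=
    (v - 1)x. So no part of the union has more edges per vertex than a tree on v vertices, however
    many blocks there are. *)
Lemma block_rel_density (K : finType) (v : nat) (e : K -> rel 'I_v)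
    (S : {set K * 'I_v}) :
  (forall k (X : {set 'I_v}), X != set0 -> ep (e k) X + 2 <= 2 * #|X|) ->
  v * ep (block_rel e) S <= 2 * v.-1 * #|S|.
Proof.
move=> sparse; pose X k := [set a | (k, a) \in S].
have sumS (F : K * 'I_v -> nat) : \sum_(a in S) F a = \sum_k \sum_(a in X k) F (k, a).
  rewrite pair_big_dep /=; apply: eq_big => [[k a]|[k a] _] //.
  by rewrite inE.
have -> : #|S| = \sum_k #|X k|.
  by rewrite -sum1_card sumS; apply: eq_bigr => k _; rewrite sum1_card.
have -> : ep (block_rel e) S = \sum_k ep (e k) (X k).
  rewrite /ep sumS; apply: eq_bigr => k _; apply: eq_bigr => a _.
  rewrite sumS (bigD1 k) //= [X in _ + X]big1 ?addn0.
    by apply: eq_bigr => c _; rewrite /block_rel /= eqxx.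
  by move=> l lk; rewrite big1 // => c _; rewrite /block_rel /= eq_sym (negPf lk).
rewrite !big_distrr /=; apply: leq_sum => k _.
have [->|X0] := eqVneq (X k) set0; first by rewrite ep0 muln0.
have := sparse k _ X0; have : #|X k| <= v by rewrite -[v in _ <= v]card_ord max_card.
move: (ep _ _) #|X k| => q x; case: (v) => [|w]; first by lia.
move=> xw qx; have : w.+1 * (q + 2) <= w.+1 * (2 * x) by rewrite leq_mul2l qx orbT.
by rewrite mulnDr /= => ?; nia.
Qed.

(** Kinds are indexed by the vertices of [H], but the final copy uses, for each component, only the
    board won for its root. Boards of different kinds are disjoint, so the pieces do not collide. *)
Lemma client_wins_boards (b : nat) (VH : finType) (eH : rel VH) (v : nat)
    (e : VH -> rel 'I_v) : simple_graph eH ->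
  (forall x, cwin b (has_copy eH (component eH x) (e x)) set0 setT) ->
  exists M : nat, forall (V : finType) (eG : rel V) (f : VH * 'I_M * 'I_v -> V),
    injective f ->
    (forall a c, block_rel (fun k : VH * 'I_M => e k.1) a c -> eG (f a) (f c)) ->
    client_wins b eH setT eG.
Proof.
move=> [se _] win; have [M HM] := cwin_board_types b (enum VH) v 0.
have symc : connect_sym eH by apply: sym_connect_sym.
exists M.+1 => V eG f injf homf.
pose B x i := [set f (x, inord i, a) | a in 'I_v].
pose W2 x i (C : {set V}) := has_copy eH (component eH x) eG (C :&: B x i).
have dB x y i j : i < M -> j < M -> (x, i) != (y, j) -> [disjoint B x i & B y j].
  move=> iM jM ne; rewrite -setI_eq0; apply/eqP/setP => z; rewrite !inE.
  apply/negP => /andP[/imsetP[a _ ->] /imsetP[c _ /injf [xy + _]]].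
  move/(congr1 val); rewrite /= !inordK ?ltnS ?(ltnW iM) ?(ltnW jM) // => ij.
  by rewrite xy ij eqxx in ne.
rewrite client_winsE.
apply: cwin_sub (HM V set0 predT B W2 _ _ _ _ _ _ _) => //.
- move=> C /= /allP HC.
  have /fin_all_exists[i Hi] : forall x, exists i, i < M /\ W2 x i C.
    move=> x; have /hasP[i] := HC x (mem_enum _ _).
    by rewrite mem_iota add0n => /andP[_ iM] ?; exists i.
  have /fin_all_exists[g Hg] : forall x, exists g : VH -> V,
      [/\ {in component eH x, forall z, g z \in C :&: B x (i x)},
          {in component eH x &, injective g} &
          {in component eH x &, forall z w, eH z w -> eG (g z) (g w)}].
    by move=> x; have [_ /has_copyP] := Hi x.
  have rt z : z \in component eH (fingraph.root eH z).
    by rewrite inE symc connect_root.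
  apply/has_copyP; exists (fun z => g (fingraph.root eH z) z); split.
  + move=> z _; have [gC _ _] := Hg (fingraph.root eH z).
    by have /setIP[] := gC z (rt z).
  + move=> z w _ _ /= E; have [rzw|rzw] := eqVneq (fingraph.root eH z) (fingraph.root eH w).
      have [_ inj _] := Hg (fingraph.root eH w); apply: inj => //; last by rewrite -E rzw.
      by rewrite -rzw.
    have [gz _ _] := Hg (fingraph.root eH z); have [gw _ _] := Hg (fingraph.root eH w).
    have /setIP[_ zB] := gz z (rt z); have /setIP[_ wB] := gw w (rt w).
    have /pred0P /(_ (g (fingraph.root eH w) w)) /= :
        [disjoint B (fingraph.root eH z) (i (fingraph.root eH z)) &
        B (fingraph.root eH w) (i (fingraph.root eH w))].
      apply: dB; [by case: (Hi (fingraph.root eH z)) | by case: (Hi (fingraph.root eH w)) |].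
      by apply: contraNneq rzw => -[->].
    by rewrite wB -E zB.
  + move=> z w _ _ ezw; have rzw : fingraph.root eH z = fingraph.root eH w.
      by apply/eqP; rewrite root_connect // connect1.
    have [_ _ hom] := Hg (fingraph.root eH w); rewrite rzw; apply: hom => //.
    by rewrite -rzw.
- exact: enum_uniq.
- by move=> x i C C' CC'; apply: has_copy_mono; apply: setSI.
- by move=> x y i j _ _; apply: dB.
- move=> x i _ iM; split.
  + by rewrite disjoints_subset sub0set.
  + by apply: leq_trans (leq_imset_card _ _) _; rewrite card_ord.
  + rewrite -(imset0 (fun a : 'I_v => f (x, inord i, a))).
    have -> : B x i = [set f (x, inord i, a) | a in [set: 'I_v]].
      by apply/setP => z; apply/imsetP/imsetP => -[a _ ->]; exists a.
    have fI : injective (fun a : 'I_v => f (x, inord i, a)) by move=> a c /injf[].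
    apply: cwin_image (win x) => // C.
    move=> /(has_copy_image (eG' := eG) fI) H; rewrite /W2 (setIidPl _).
      by apply: H => a c eac; apply: homf; rewrite /block_rel /= eqxx.
    by apply/subsetP => _ /imsetP[a _ ->]; apply: imset_f.
- by rewrite cards0.
- by rewrite cwin0.
Qed.

(** * Random subsets: first and second moment bounds *)

Section Bernoulli.
Local Open Scope ring_scope.
Import Order.TTheory GRing.Theory Num.Theory.
Context {R : realFieldType} {T : finType}.
Implicit Types (p : R) (S E : {set T}).

Definition bern p E : R := p ^+ #|E| * (1 - p) ^+ (#|T| - #|E|).

Definition Pr p (Q : pred {set T}) : R := \sum_(E | Q E) bern p E.

Lemma bern_prod p E : bern p E = \prod_t (if t \in E then p else 1 - p).
Proof.
rewrite (bigID (mem E)) /= (eq_bigr (fun=> p)); last by move=> t ->.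
rewrite prodr_const; congr (_ * _).
rewrite (eq_bigr (fun=> 1 - p)); last by move=> t /negPf ->.
rewrite (eq_bigl (mem (~: E))); last by move=> t; rewrite !inE.
by rewrite prodr_const [in RHS]cardsCs setCK.
Qed.

(** Expand the product over [t] of [p] plus 0 or [1 - p], according as [t] lies in [S] or not: only
    sets containing [S] contribute. *)
Lemma bern_superset p S : \sum_(E : {set T} | S \subset E) bern p E = p ^+ #|S|.
Proof.
have : \prod_t (p + (if t \in S then 0 else 1 - p)) = \sum_(J in {set T})
    \prod_t (if t \in J then p else if t \in S then 0 else 1 - p).
  exact: bigA_distr.
rewrite (eq_bigr (fun t => if t \in S then p else 1)); last first.
  by move=> t _; case: ifP => _; rewrite ?addr0 // addrC subrK.
rewrite -big_mkcond prodr_const => ->.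
rewrite [RHS](bigID (fun E : {set T} => S \subset E)) /= [X in _ = _ + X]big1 ?addr0; last first.
  move=> E /subsetPn[t tS tE]; rewrite (bigD1 t) //= (negPf tE) tS.
  by rewrite mul0r.
apply: eq_big => // E SE; rewrite bern_prod; apply: eq_bigr => t _.
case: ifP => // tE; case: ifP => // tS.
by rewrite (subsetP SE) in tE.
Qed.

Lemma bern_total p : \sum_(E : {set T}) bern p E = 1.
Proof.
rewrite -[RHS](expr0 p) -(cards0 T) -bern_superset.
by apply: eq_bigl => E; rewrite sub0set.
Qed.

Lemma bern_ind p S : \sum_(E : {set T}) bern p E * (S \subset E)%:R = p ^+ #|S|.
Proof.
rewrite -bern_superset [RHS]big_mkcond /=; apply: eq_bigr => E _.
by case: ifP; rewrite ?mulr1 ?mulr0.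
Qed.

Lemma bern_ge0 p E : 0 <= p <= 1 -> 0 <= bern p E.
Proof. by move=> /andP[p0 p1]; rewrite mulr_ge0 ?exprn_ge0 // subr_ge0. Qed.

Lemma Pr_compl p (Q : pred {set T}) : Pr p Q = 1 - Pr p (predC Q).
Proof. by rewrite -(bern_total p) (bigID Q) /= addrK. Qed.

Lemma Pr_ge0 p (Q : pred {set T}) : 0 <= p <= 1 -> 0 <= Pr p Q.
Proof. by move=> p01; apply: sumr_ge0 => E _; apply: bern_ge0. Qed.

Lemma Pr_sub p (Q Q' : pred {set T}) : 0 <= p <= 1 ->
  (forall E, Q E -> Q' E) -> Pr p Q <= Pr p Q'.
Proof.
move=> p01 QQ'; rewrite /Pr [leRHS](bigID Q) /=.
rewrite (eq_bigl Q) => [|E]; last by case QE: (Q E); rewrite ?andbF ?QQ'.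
by rewrite lerDl; apply: sumr_ge0 => E _; apply: bern_ge0.
Qed.

Lemma Pr_union p (I : finType) (P : pred I) (Q' : I -> pred {set T}) (Q : pred {set T}) :
  0 <= p <= 1 -> (forall E, Q E -> exists2 i, P i & Q' i E) ->
  Pr p Q <= \sum_(i | P i) Pr p (Q' i).
Proof.
move=> p01 HQ; rewrite /Pr [leLHS]big_mkcond /=.
rewrite (eq_bigr (fun i => \sum_E (if Q' i E then bern p E else 0))); last first.
  by move=> i _; rewrite big_mkcond.
rewrite exchange_big /=; apply: ler_sum => E _; case: ifP => [/HQ[i Pi Q'i]|_].
  rewrite (bigD1 i) //= Q'i lerDl; apply: sumr_ge0 => j _.
  by case: ifP => // _; apply: bern_ge0.
by apply: sumr_ge0 => j _; case: ifP => // _; apply: bern_ge0.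
Qed.

Lemma Pr_first_moment p (I : finType) (P : pred I) (S : I -> {set T}) (Q : pred {set T}) :
  0 <= p <= 1 -> (forall E, Q E -> exists2 i, P i & S i \subset E) ->
  Pr p Q <= \sum_(i | P i) p ^+ #|S i|.
Proof.
move=> p01 HQ; apply: le_trans (Pr_union (Q' := fun i E => S i \subset E) p01 HQ) _.
by apply: ler_sum => i _; rewrite /Pr bern_superset.
Qed.

(** Chebyshev's inequality for the number [X] of indices [i] with [S i] inside the random set: where
    [X] vanishes, its squared deviation from the mean is [mu ^+ 2]. *)
Lemma Pr_second_moment p (I : finType) (S : I -> {set T}) (e : nat) :
  0 <= p <= 1 -> (forall i, #|S i| = e) ->
  Pr p (fun E => [forall i, ~~ (S i \subset E)]) * (#|I|%:R * p ^+ e) ^+ 2 <=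
  \sum_i \sum_j p ^+ #|S i :|: S j| - (#|I|%:R * p ^+ e) ^+ 2.
Proof.
move=> p01 Se; set mu := #|I|%:R * p ^+ e.
pose X E : R := \sum_i (S i \subset E)%:R.
have EX : \sum_E bern p E * X E = mu.
  rewrite (eq_bigr (fun E => \sum_i bern p E * (S i \subset E)%:R)); last first.
    by move=> E _; rewrite mulr_sumr.
  rewrite exchange_big /= (eq_bigr (fun=> p ^+ e)); last first.
    by move=> i _; rewrite bern_ind Se.
  by rewrite sumr_const /mu mulr_natl.
have EX2 : \sum_E bern p E * X E ^+ 2 = \sum_i \sum_j p ^+ #|S i :|: S j|.
  rewrite (eq_bigr (fun E => \sum_i \sum_j bern p E * (S i :|: S j \subset E)%:R)).
    rewrite exchange_big /=; apply: eq_bigr => i _.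
    by rewrite exchange_big /=; apply: eq_bigr => j _; rewrite bern_ind.
  move=> E _; rewrite expr2 /X mulr_suml mulr_sumr; apply: eq_bigr => i _.
  rewrite mulr_sumr mulr_sumr; apply: eq_bigr => j _.
  by rewrite subUset -natrM mulnb.
have -> : \sum_i \sum_j p ^+ #|S i :|: S j| - mu ^+ 2 =
    \sum_E bern p E * (X E - mu) ^+ 2.
  rewrite -EX2 [RHS](eq_bigr (fun E => bern p E * X E ^+ 2 +
     (- (2 * mu)) * (bern p E * X E) + mu ^+ 2 * bern p E)); last by move=> E _; ring.
  rewrite !big_split /= -!mulr_sumr EX bern_total; ring.
rewrite /Pr mulr_suml [leRHS](bigID (fun E => [forall i, ~~ (S i \subset E)])) /=.
rewrite -[leLHS]addr0; apply: lerD.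
  apply: ler_sum => E /forallP none; rewrite /X big1 ?sub0r ?sqrrN //.
  by move=> i _; rewrite (negPf (none i)).
by apply: sumr_ge0 => E _; rewrite mulr_ge0 ?bern_ge0 // sqr_ge0.
Qed.

End Bernoulli.

(** * Dense vertex sets in G(n,p) *)

Lemma gadj_simple (n : nat) (E : {set epair n}) : simple_graph (gadj E).
Proof.
split=> [i j|i].
  by apply: eq_existsb => u; rewrite orbC.
apply/existsP => -[u /andP[_]]; rewrite orbb => /andP[/eqP ui /eqP uj].
by have := valP u; rewrite /= ui uj ltnn.
Qed.

Definition inner_pairs (n : nat) (S : {set 'I_n}) : {set epair n} :=
  [set u | ((val u).1 \in S) && ((val u).2 \in S)].

Lemma card_inner_pairs (n : nat) (S : {set 'I_n}) : #|inner_pairs S| <= #|S| * #|S|.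
Proof.
rewrite -cardsX -(card_imset _ val_inj); apply: subset_leq_card.
by apply/subsetP => _ /imsetP[u + ->]; rewrite !inE.
Qed.

Lemma ep_gadj (n : nat) (E : {set epair n}) (S : {set 'I_n}) :
  ep (gadj E) S <= 2 * #|E :&: inner_pairs S|.
Proof.
set D := E :&: inner_pairs S.
pose N i j := \sum_(u in D) (val u == (i, j)).
have sumN : \sum_i \sum_j N i j = #|D|.
  rewrite pair_big /= (eq_bigr (fun p => \sum_(u in D) (val u == p))); last first.
    by move=> [i j] _.
  rewrite exchange_big /= -sum1_card; apply: eq_bigr => u _.
  rewrite (bigD1 (val u)) //= eqxx big1 // => p pu.
  by rewrite eq_sym (negPf pu).
have le i j : i \in S -> j \in S -> gadj E i j <= N i j + N j i.
  move=> iS jS; rewrite /gadj; case: existsP => // -[u /andP[uE]].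
  have aux a c : a \in S -> c \in S -> ((val u).1 == a) && ((val u).2 == c) -> 0 < N a c.
    move=> aS cS /andP[/eqP ua /eqP uc].
    rewrite /N (bigD1 u) /=; first by rewrite -ua -uc -surjective_pairing eqxx.
    by rewrite !inE uE ua uc aS cS.
  by case/orP => /aux H; [have := H iS jS | have := H jS iS]; lia.
have sub (F : 'I_n -> nat) : \sum_(i in S) F i <= \sum_i F i.
  by rewrite [leqRHS](bigID (mem S)) leq_addr.
apply: (@leq_trans (\sum_(i in S) \sum_(j in S) (N i j + N j i))).
  by apply: leq_sum => i iS; apply: leq_sum => j; apply: le.
apply: (@leq_trans (\sum_i \sum_j (N i j + N j i))).
  by apply: leq_trans (sub _) _; apply: leq_sum => i _; apply: sub.
rewrite (eq_bigr (fun i => \sum_j N i j + \sum_j N j i)); last first.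
  by move=> i _; rewrite big_split.
have sumN' : \sum_i \sum_j N j i = #|D| by rewrite exchange_big.
by rewrite big_split /= sumN sumN' mul2n addnn.
Qed.

Lemma subset_of_card (T : finType) (D : {set T}) q : q <= #|D| ->
  exists2 D' : {set T}, D' \subset D & #|D'| = q.
Proof.
move=> qD; exists [set x in take q (enum D)].
  by apply/subsetP => x; rewrite inE => /mem_take; rewrite mem_enum.
rewrite cardsE; have /card_uniqP -> : uniq (take q (enum D)).
  by apply: take_uniq; apply: enum_uniq.
by rewrite size_takel // -cardE.
Qed.

Lemma ffact_leq_exp n m : n ^_ m <= n ^ m.
Proof.
elim: m n => // m IH n; rewrite ffactnS expnS leq_mul2l.
apply/orP; right; apply: leq_trans (IH _) _.
by case: m {IH} => // m; rewrite leq_exp2r // leq_pred.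
Qed.

Lemma bin_leq_exp n m : 'C(n, m) <= n ^ m.
Proof.
apply: leq_trans (ffact_leq_exp n m); rewrite -bin_ffact leq_pmulr //.
exact: fact_gt0.
Qed.

Section Sparse.
Local Open Scope ring_scope.
Import Order.TTheory GRing.Theory Num.Theory.

(** Union bound over a [w]-set [S] and [q] pairs inside it: at most [n ^ w] choices of [S], then at
    most [2 ^ (w * w)] sets of pairs. *)
Lemma Pr_dense_set (R : realFieldType) (n w q : nat) (p : R) : 0 <= p <= 1 ->
  Pr p (fun E : {set epair n} =>
     [exists S : {set 'I_n}, (#|S| == w) && (2 * q <= ep (gadj E) S)%N]) <=
  ((n ^ w * 2 ^ (w * w))%N)%:R * p ^+ q.
Proof.
move=> p01; have p0 : 0 <= p by case/andP: p01.
pose P (i : {set 'I_n} * {set epair n}) :=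
  (#|i.1| == w) && ((i.2 \subset inner_pairs i.1) && (#|i.2| == q)).
apply: le_trans (Pr_first_moment (P := P) (S := snd) p01 _) _.
  move=> E /existsP[S /andP[Sw qS]].
  have : (q <= #|E :&: inner_pairs S|)%N by have := ep_gadj E S; lia.
  case/subset_of_card => D DE Dq; exists (S, D); last first.
    exact: subset_trans DE (subsetIl _ _).
  by rewrite /P /= Sw Dq eqxx andbT /=; apply: subset_trans DE (subsetIr _ _).
rewrite (eq_bigr (fun=> p ^+ q)) => [|i /and3P[_ _ /eqP ->] //].
rewrite sumr_const -[leLHS]mulr_natl; apply: ler_wpM2r; first exact: exprn_ge0.
rewrite ler_nat.
rewrite -sum1_card -(pair_big_dep (fun S : {set 'I_n} => #|S| == w)
  (fun S (D : {set epair n}) => (D \subset inner_pairs S) && (#|D| == q)) (fun _ _ => 1%N)) /=.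
apply: (@leq_trans (\sum_(S : {set 'I_n} | #|S| == w) 2 ^ (w * w))%N).
  apply: leq_sum => S /eqP Sw; rewrite sum1_card.
  apply: (@leq_trans #|powerset (inner_pairs S)|).
    by apply: subset_leq_card; apply/subsetP => D /andP[DS _]; rewrite inE.
  by rewrite card_powerset leq_exp2l // -Sw card_inner_pairs.
rewrite sum_nat_const leq_mul2r; apply/orP; right.
apply: leq_trans (bin_leq_exp n w); rewrite -[n in 'C(n, _)]card_ord -card_draws.
by apply: subset_leq_card; apply/subsetP => S; rewrite !inE.
Qed.

End Sparse.

(** * Labelled copies of a fixed graph in G(n,p) *)

Section Labellings.
Context {U : finType} {e : rel U} {s n : nat}.
Context (se : simple_graph e) (sn : #|U| * s <= n).

(* Vertex a of U gets its own block of s vertices of 'I_n; blocks are ordered as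
   the ranks of their vertices, so that a pair of nodes is an epair as soon as
   the ranks are ordered. *)
Lemma node_subproof (a : U) (i : 'I_s) : enum_rank a * s + i < n.
Proof.
apply: leq_trans sn; apply: (@leq_trans ((enum_rank a).+1 * s)).
  by rewrite mulSn addnC ltn_add2r.
by rewrite leq_mul2r ltn_ord orbT.
Qed.

Definition node (a : U) (i : 'I_s) : 'I_n := Ordinal (node_subproof a i).

Lemma node_inj a c i j : node a i = node c j -> a = c /\ i = j.
Proof.
move=> /(congr1 val) /= E; have s0 : 0 < s by apply: leq_ltn_trans (ltn_ord i).
have ra : enum_rank a = enum_rank c.
  apply: val_inj; have := congr1 (fun m => m %/ s) E.
  by rewrite /= !divnMDl // !divn_small // !addn0.
split; first exact: enum_rank_inj.
by apply: val_inj; move: E; rewrite ra => /addnI.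
Qed.

Lemma node_lt a c i j : enum_rank a < enum_rank c -> node a i < node c j.
Proof.
move=> ac /=; apply: (@leq_trans ((enum_rank a).+1 * s)).
  by rewrite mulSn addnC ltn_add2r.
by apply: leq_trans (leq_addr _ _); rewrite leq_mul2r ac orbT.
Qed.

(** Each edge occurs once, directed by increasing rank, so that its nodes come in the order [epair]
    requires. *)
Definition edge_of := {d : U * U | (enum_rank d.1 < enum_rank d.2) && e d.1 d.2}.

Lemma node_edge_subproof (x : {ffun U -> 'I_s}) (d : edge_of) :
  let q := (node (val d).1 (x (val d).1), node (val d).2 (x (val d).2)) in q.1 < q.2.
Proof. by apply: node_lt; case/andP: (valP d). Qed.

Definition node_edge (x : {ffun U -> 'I_s}) (d : edge_of) : epair n :=
  exist (fun q : 'I_n * 'I_n => is_true (q.1 < q.2))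
    (node (val d).1 (x (val d).1), node (val d).2 (x (val d).2)) (node_edge_subproof x d).

Definition labelled_edges (x : {ffun U -> 'I_s}) : {set epair n} :=
  node_edge x @: [set: edge_of].

Definition edges_in (A : {set U}) : {set edge_of} :=
  [set d | ((val d).1 \in A) && ((val d).2 \in A)].

Lemma node_edge_eq x y d d' : node_edge x d = node_edge y d' ->
  [/\ d = d', x (val d).1 = y (val d).1 & x (val d).2 = y (val d).2].
Proof.
move=> E; have E1 : node (val d).1 (x (val d).1) = node (val d').1 (y (val d').1).
  exact: (congr1 (fun u : epair n => (val u).1) E).
have E2 : node (val d).2 (x (val d).2) = node (val d').2 (y (val d').2).
  exact: (congr1 (fun u : epair n => (val u).2) E).
have [d1 x1] := node_inj E1; have [d2 x2] := node_inj E2.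
have dd : d = d' by apply: val_inj; rewrite [LHS]surjective_pairing d1 d2 -surjective_pairing.
by rewrite x1 x2 dd.
Qed.

Lemma card_labelled_edges x : #|labelled_edges x| = #|[set: edge_of]|.
Proof. by rewrite card_imset // => d d' /node_edge_eq[]. Qed.

(** Two labellings share exactly the edges whose ends carry equal labels; the rest is
    inclusion-exclusion. *)
Lemma card_labelled_edgesU x y :
  #|labelled_edges x :|: labelled_edges y| + #|edges_in [set a | x a == y a]| =
  2 * #|[set: edge_of]|.
Proof.
have -> : #|edges_in [set a | x a == y a]| = #|labelled_edges x :&: labelled_edges y|.
  have inj : injective (node_edge x) by move=> d d' /node_edge_eq[].
  rewrite -(card_imset _ inj); apply: eq_card => u; rewrite inE.
  apply/imsetP/andP => [[d dA ->]|[/imsetP[d _ ->] /imsetP[d' _ /node_edge_eq[dd e1 e2]]]].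
    split; first exact: imset_f.
    move: dA; rewrite !inE => /andP[/eqP e1 /eqP e2].
    apply/imsetP; exists d => //; apply: val_inj.
    by rewrite /= e1 e2.
  by exists d => //; rewrite !inE e1 e2 !eqxx.
by rewrite cardsUI !card_labelled_edges mul2n addnn.
Qed.

Lemma ep_edges_in (A : {set U}) : ep e A = 2 * #|edges_in A|.
Proof.
have [sym irr] := se.
pose lt (a c : U) := enum_rank a < enum_rank c.
have half : \sum_(a in A) \sum_(c in A) (lt a c && e a c) = #|edges_in A|.
  rewrite pair_big /= -(card_imset _ val_inj) -sum1_card.
  rewrite (bigID (fun p : U * U => lt p.1 p.2 && e p.1 p.2)) /= [X in _ + X]big1 ?addn0.
    apply: eq_big => [p|p /andP[_ ->] //]; apply/andP/imsetP => [[pA pe]|[d dA ->]].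
      by exists (Sub p pe); rewrite ?SubK // inE SubK.
    by move: dA (valP d); rewrite inE.
  by move=> p /andP[_ /negPf ->].
have -> : ep e A = \sum_(a in A) \sum_(c in A) (lt a c && e a c) +
    \sum_(a in A) \sum_(c in A) (lt c a && e c a).
  rewrite -big_split; apply: eq_bigr => a _ /=; rewrite -big_split; apply: eq_bigr => c _ /=.
  rewrite /lt (sym c a); case: ltngtP => //=; rewrite ?addn0 //.
  by move=> /val_inj /enum_rank_inj ->; rewrite irr.
by rewrite [X in _ + X]exchange_big /= half mul2n addnn.
Qed.

Lemma labelled_hom (x : {ffun U -> 'I_s}) (E : {set epair n}) a c :
  labelled_edges x \subset E -> e a c -> gadj E (node a (x a)) (node c (x c)).
Proof.
move=> sub; have [sym irr] := se.
have aux a' c' : enum_rank a' < enum_rank c' -> e a' c' ->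
    gadj E (node a' (x a')) (node c' (x c')).
  move=> lt eac; have dP : (enum_rank (a', c').1 < enum_rank (a', c').2) && e (a', c').1 (a', c').2.
    by rewrite /= lt.
  apply/existsP; exists (node_edge x (exist _ (a', c') dP)).
  by rewrite (subsetP sub) ?imset_f ?inE //= !eqxx.
have [gsym _] := gadj_simple E.
move=> eac; have [lt|lt|/val_inj/enum_rank_inj ac] := ltngtP (enum_rank a) (enum_rank c).
- exact: aux.
- by rewrite gsym; apply: aux; rewrite // sym.
- by rewrite ac irr in eac.
Qed.

(** For fixed [x], the labels of [y] are forced on [A] and free elsewhere; the factor [s ^ #|A|]
    avoids a subtraction in the exponent. *)
Lemma card_agree (A : {set U}) :
  \sum_(x : {ffun U -> 'I_s}) \sum_(y : {ffun U -> 'I_s}) [forall a in A, x a == y a] * s ^ #|A| =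
  s ^ (2 * #|U|).
Proof.
have fib (x : {ffun U -> 'I_s}) :
    \sum_(y : {ffun U -> 'I_s}) [forall a in A, x a == y a] * s ^ #|A| = s ^ #|U|.
  have E : \prod_(a : U) \sum_(i : 'I_s) ((a \in A) ==> (x a == i)) =
      \sum_(y : {ffun U -> 'I_s}) \prod_(a : U) ((a \in A) ==> (x a == y a)).
    exact: bigA_distr_bigA.
  rewrite -big_distrl /= (eq_bigr (fun y : {ffun U -> 'I_s} =>
      \prod_(a : U) (((a \in A) ==> (x a == y a)) : nat))); last first.
    move=> y _; case: forallP => [all|/forallP]; first by rewrite big1 // => a _; rewrite all.
    by rewrite negb_forall => /existsP[a na]; rewrite (bigD1 a) //= (negPf na).
  rewrite -E (bigID (mem A)) /= big1 ?mul1n => [|a aA]; last first.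
    rewrite aA /= (bigD1 (x a)) //= eqxx big1 // => i ix.
    by rewrite eq_sym (negPf ix).
  rewrite (eq_bigr (fun=> s)) => [|a /negPf ->]; last first.
    by rewrite sum1_card card_ord.
  rewrite prod_nat_const -expnD; congr (_ ^ _).
  rewrite (@eq_card _ _ (~: A)) => [|a]; last by rewrite !inE.
  by rewrite addnC cardsC.
rewrite (eq_bigr (fun=> s ^ #|U|)) => [|x _]; last exact: fib.
by rewrite sum_nat_const card_ffun card_ord -expnD mul2n addnn.
Qed.

Local Open Scope ring_scope.
Import Order.TTheory GRing.Theory Num.Theory.

(** [L] is a lower bound for the expected number of labelled copies of each part with an edge. Only
    pairs of labellings agreeing on such a part add to the variance, and each of the at most
    [2 ^ #|U|] parts adds at most [mu ^+ 2 / L]. *)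
Lemma Pr_no_labelling (R : realFieldType) (p L : R) : 0 < p <= 1 -> 0 < L -> (0 < s)%N ->
  (forall A : {set U}, (0 < ep e A)%N -> L <= s%:R ^+ #|A| * p ^+ #|edges_in A|) ->
  Pr p (fun E : {set epair n} => [forall x, ~~ (labelled_edges x \subset E)]) <=
  2 ^+ #|U| / L.
Proof.
move=> /andP[p0 p1] L0 s0 dens; have p01 : 0 <= p <= 1 by rewrite ltW.
set m := #|[set: edge_of]|.
have := Pr_second_moment p01 card_labelled_edges; rewrite -/m.
rewrite card_ffun card_ord natrX; set mu := s%:R ^+ #|U| * p ^+ m.
have s0R : 0 < s%:R :> R by rewrite ltr0n.
have mu0 : 0 < mu by rewrite mulr_gt0 ?exprn_gt0.
have mu2 : 0 < mu ^+ 2 by rewrite exprn_gt0.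
have mu2E : mu ^+ 2 = s%:R ^+ (2 * #|U|) * p ^+ (2 * m).
  by rewrite /mu exprMn -!exprM ![(_ * 2)%N]mulnC.
pose ag (x y : {ffun U -> 'I_s}) := [set a | x a == y a].
have edge_le A : (#|edges_in A| <= 2 * m)%N.
  by apply: leq_trans (leq_pmull _ _) => //; apply: subset_leq_card; apply: subsetT.
have unionE x y : p ^+ #|labelled_edges x :|: labelled_edges y| =
    p ^+ (2 * m - #|edges_in (ag x y)|).
  by congr (_ ^+ _); rewrite /m -(card_labelled_edgesU x y) addnK.
(* The summand for the set where [x] and [y] agree already suffices; if that set spans no edge, the
   left side is zero. *)
have term (x y : {ffun U -> 'I_s}) : p ^+ (2 * m - #|edges_in (ag x y)|) - p ^+ (2 * m) <=
    \sum_(A : {set U} | (0 < #|edges_in A|)%N)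
       [forall a in A, x a == y a]%:R * p ^+ (2 * m - #|edges_in A|).
  have ge0 (A : {set U}) : 0 <= [forall a in A, x a == y a]%:R * p ^+ (2 * m - #|edges_in A|) :> R.
    by rewrite mulr_ge0 ?exprn_ge0 ?ler0n // ltW.
  have [E0|Epos] := posnP #|edges_in (ag x y)|.
    by rewrite E0 subn0 subrr; apply: sumr_ge0.
  rewrite (bigD1 (ag x y)) //= (_ : [forall a in _, _]); last first.
    by apply/forall_inP => a; rewrite inE.
  rewrite mul1r; apply: lerD; first by [].
  rewrite (@le_trans _ _ 0) //; last by apply: sumr_ge0.
  by rewrite oppr_le0 exprn_ge0 // ltW.
have bound : \sum_x \sum_y p ^+ #|labelled_edges x :|: labelled_edges y| - mu ^+ 2 <=
    2 ^+ #|U| / L * mu ^+ 2.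
  have muS : mu ^+ 2 = \sum_(x : {ffun U -> 'I_s}) \sum_(y : {ffun U -> 'I_s}) p ^+ (2 * m).
    rewrite !sumr_const card_ffun card_ord -mulrnA -[RHS]mulr_natl natrM natrX mu2E.
    by rewrite -exprD mul2n addnn.
  rewrite {1}muS -sumrB.
  apply: (@le_trans _ _ (\sum_(x : {ffun U -> 'I_s}) \sum_(y : {ffun U -> 'I_s})
    \sum_(A : {set U} | (0 < #|edges_in A|)%N)
       [forall a in A, x a == y a]%:R * p ^+ (2 * m - #|edges_in A|))).
    apply: ler_sum => x _; rewrite -sumrB; apply: ler_sum => y _.
    by rewrite unionE; apply: term.
  rewrite (eq_bigr (fun x : {ffun U -> 'I_s} => \sum_(A : {set U} | (0 < #|edges_in A|)%N)
    \sum_(y : {ffun U -> 'I_s}) [forall a in A, x a == y a]%:R * p ^+ (2 * m - #|edges_in A|))).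
    rewrite exchange_big /=.
    apply: (@le_trans _ _ (\sum_(A : {set U} | (0 < #|edges_in A|)%N) mu ^+ 2 / L)).
      apply: ler_sum => A A0; rewrite ler_pdivlMr //.
      set N := (\sum_(x : {ffun U -> 'I_s}) \sum_(y : {ffun U -> 'I_s})
                  [forall a in A, x a == y a])%N.
      have -> : \sum_(x : {ffun U -> 'I_s}) \sum_(y : {ffun U -> 'I_s})
          [forall a in A, x a == y a]%:R * p ^+ (2 * m - #|edges_in A|) =
          N%:R * p ^+ (2 * m - #|edges_in A|).
        rewrite /N natr_sum mulr_suml; apply: eq_bigr => x _.
        by rewrite natr_sum mulr_suml.
      have NE : N%:R * s%:R ^+ #|A| = s%:R ^+ (2 * #|U|) :> R.
        rewrite -!natrX -natrM -(card_agree A) /N big_distrl /=.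
        by congr (_%:R); apply: eq_bigr => x _; rewrite big_distrl.
      apply: (@le_trans _ _ (N%:R * p ^+ (2 * m - #|edges_in A|) *
          (s%:R ^+ #|A| * p ^+ #|edges_in A|))).
        apply: ler_wpM2l; first by rewrite mulr_ge0 ?ler0n ?exprn_ge0 // ltW.
        by apply: dens; rewrite ep_edges_in muln_gt0.
      by rewrite mulrACA NE -exprD subnK // mu2E.
    apply: (@le_trans _ _ (\sum_(A : {set U}) mu ^+ 2 / L)).
      rewrite [leRHS](bigID (fun A : {set U} => (0 < #|edges_in A|)%N)) /= lerDl.
      by apply: sumr_ge0 => A _; rewrite divr_ge0 // ltW.
    rewrite sumr_const -[leLHS]mulr_natl.
    have -> : #|{set U}| = (2 ^ #|U|)%N.
      by rewrite -(cardsT U) -card_powerset; apply: eq_card => A; rewrite !inE subsetT.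
    by rewrite natrX mulrCA mulrC [_ / L * _]mulrC mulrC !mulrA.
  by move=> x _; rewrite exchange_big.
by move=> /le_trans /(_ bound); rewrite ler_pM2r.
Qed.

End Labellings.

(** * Minimum winning trees *)

(** Descending in size from any winning tree reaches a minimum one, to which the bound applies. *)
Lemma winning_tree_leq (b : nat) (VH : finType) (eH : rel VH) x v :
  is_forest eH ->
  (forall (VT : finType) (eT : rel VT),
     min_winning_tree b eH (component eH x) eT -> #|VT| <= v) ->
  exists (VT : finType) (eT : rel VT),
    [/\ is_tree eT, client_wins b eH (component eH x) eT & #|VT| <= v].
Proof.
move=> fH minv; apply: NNPP => none.
have [VT [eT [tT winT]]] := grown_winning_tree b fH (component_grown x fH.1).
have [n] := ubnP #|VT|; elim: n VT eT tT winT => // n IH VT eT tT winT Tn.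
apply: none; exists VT, eT; split=> //; apply: (minv _ eT); split=> // VT' eT' tT' winT'.
rewrite leqNgt; apply/negP => lt; apply: IH tT' winT' _.
exact: leq_trans lt _.
Qed.

(** Yields [1 < v], so that the exponent [v / (v - 1)] makes sense. *)
Lemma winning_host_gt1 (b : nat) (VH : finType) (eH : rel VH) x y
    (V : finType) (e : rel V) :
  simple_graph eH -> eH x y -> client_wins b eH (component eH x) e -> 1 < #|V|.
Proof.
move=> [_ irr] exy; rewrite client_winsE => /cwin_ex[C /has_copyP[f [_ injf _]]].
have xy : x != y by apply: contraTneq exy => ->; rewrite irr.
have fxy : f x != f y.
  apply: contraNneq xy => /injf ->; rewrite ?inE ?connect0 //.
  exact: connect1.
by apply: leq_trans (max_card (mem [set f x; f y])); rewrite cards2 fxy.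
Qed.

(** * The two sides of the threshold *)

Section Asymptotics.
Local Open Scope ring_scope.
Import Order.TTheory GRing.Theory Num.Theory.

Lemma Pr_client_wins_sparse (R : realFieldType) (b : nat) (VH : finType) (eH : rel VH)
    x (v n : nat) (p eps : R) :
  (forall (VT : finType) (eT : rel VT), is_tree eT ->
     client_wins b eH (component eH x) eT -> (v <= #|VT|)%N) ->
  (1 < v)%N -> 0 <= p <= 1 -> 0 <= eps <= 1 ->
  n%:R * p <= eps -> n%:R ^+ v * p ^+ v.-1 <= eps ->
  Pr p (fun E : {set epair n} => client_wins b eH setT (gadj E)) <=
  (v * 2 ^ (v * v))%N%:R * eps.
Proof.
move=> minv v1 p01 /andP[e0 e1] np nvp; have p0 : 0 <= p by case/andP: p01.
(* The number of edges that makes a set of [w] vertices bad for Waiter: that of a cycle below [v],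
   that of a spanning tree at [v]. *)
pose q (w : nat) := if (w < v)%N then w else v.-1.
pose Q' (w : 'I_v.+1) (E : {set epair n}) :=
  [exists S : {set 'I_n}, (#|S| == w) && (2 * q w <= ep (gadj E) S)%N].
apply: le_trans (Pr_union (P := fun w : 'I_v.+1 => (0 < w)%N) (Q' := Q') p01 _) _.
  move=> E win; apply: NNPP => none.
  suff : ~~ client_wins b eH setT (gadj E) by rewrite win.
  apply: (waiter_wins_sparse minv) => //.
  - by apply: ltnW.
  - exact: gadj_simple.
  - move=> S /andP[S0 Sv]; rewrite ltnNge; apply/negP => le; apply: none.
    have SE : nat_of_ord (inord #|S| : 'I_v.+1) = #|S| by rewrite inordK // ltnS ltnW.
    exists (inord #|S|); first by rewrite SE.
    by apply/existsP; exists S; rewrite SE eqxx /q Sv.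
  - move=> S Sv; rewrite ltnNge; apply/negP => le; apply: none.
    exists (inord v); first by rewrite inordK // ltnW.
    apply/existsP; exists S; rewrite inordK // Sv eqxx /q ltnn.
    by rewrite Sv in le; lia.
apply: (@le_trans _ _ (\sum_(w < v.+1 | (0 < w)%N) (2 ^ (v * v))%N%:R * eps)).
  apply: ler_sum => w w0; apply: le_trans (Pr_dense_set _ _ _ p01) _.
  rewrite mulnC natrM -mulrA; apply: ler_pM.
  - exact: ler0n.
  - by rewrite mulr_ge0 ?ler0n ?exprn_ge0.
  - by rewrite ler_nat leq_exp2l // leq_mul // -ltnS.
  rewrite natrX /q; case: ltnP => wv.
    rewrite -exprMn; apply: (@le_trans _ _ (eps ^+ w)).
      by apply: lerXn2r; rewrite ?nnegrE ?mulr_ge0 ?ler0n.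
    by rewrite -[leRHS]expr1; apply: ler_wiXn2l.
  by have -> : nat_of_ord w = v by apply/eqP; rewrite eqn_leq wv -ltnS ltn_ord.
rewrite sumr_const -[leLHS]mulr_natl natrM mulrA; apply: ler_wpM2r => //.
apply: ler_wpM2r; first exact: ler0n.
rewrite ler_nat -sum1_card big_mkcond big_ord_recl /= add0n.
by rewrite sum1_card card_ord.
Qed.

(** Compare [v.-1]-th powers. With [K] for [s ^ v * p ^ v.-1], the exponent condition makes the
    right side at least [K ^ m], hence at least [K], as [K] is at least 1. *)
Lemma density_power (R : realFieldType) (v s a m : nat) (p L : R) :
  (1 < v)%N -> 0 < p -> 1 <= L -> (0 < s)%N -> (0 < m)%N -> (v * m <= v.-1 * a)%N ->
  L ^+ v.-1 <= s%:R ^+ v * p ^+ v.-1 -> L <= s%:R ^+ a * p ^+ m.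
Proof.
move=> v1 p0 L1 s0 m0 vm LK; have L0 : 0 <= L by apply: le_trans L1.
have s1 : 1 <= s%:R :> R by rewrite ler1n.
have sa : 0 <= s%:R ^+ a * p ^+ m by rewrite mulr_ge0 ?exprn_ge0 ?ler0n // ltW.
have v'0 : (0 < v.-1)%N by lia.
rewrite -(ler_pXn2r v'0) ?nnegrE //; apply: (le_trans LK).
set K := s%:R ^+ v * p ^+ v.-1 in LK *.
have K1 : 1 <= K by apply: le_trans LK; apply: exprn_ege1.
apply: (@le_trans _ _ (K ^+ m)); first by rewrite -[leLHS]expr1; apply: ler_weXn2l.
rewrite /K !exprMn -!exprM [(v.-1 * m)%N]mulnC; apply: ler_wpM2r.
  by rewrite exprn_ge0 // ltW.
by apply: ler_weXn2l => //; rewrite [(a * _)%N]mulnC.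
Qed.

(** For [k < n] rounding down loses at most a factor 2, so the quotient is at least
    [n / (2 (k + 1))]; the larger constant on the left pays for this. *)
Lemma floor_power (R : realFieldType) (n k v : nat) (p L : R) :
  (1 < v)%N -> 0 <= p -> 0 <= L -> (k < n)%N ->
  (L * (2 * k.+1)%N%:R ^+ v) ^+ v.-1 <= n%:R ^+ v * p ^+ v.-1 ->
  L ^+ v.-1 <= (n %/ k.+1)%N%:R ^+ v * p ^+ v.-1.
Proof.
move=> v1 p0 L0 kn big; set c := (2 * k.+1)%N%:R : R.
have c1 : 1 <= c by rewrite ler1n.
have v'0 : (0 < v.-1)%N by lia.
have cv1 : 1 <= c ^+ v by apply: exprn_ege1.
have ns : n%:R <= (n %/ k.+1)%N%:R * c.
  rewrite -natrM ler_nat; have := divn_eq n k.+1; have := ltn_pmod n (ltn0Sn k).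
  by have : (0 < n %/ k.+1)%N by [rewrite divn_gt0]; nia.
have cv0 : 0 < c ^+ v by apply: lt_le_trans cv1.
rewrite -(ler_pM2r cv0).
apply: (@le_trans _ _ (n%:R ^+ v * p ^+ v.-1)).
  apply: le_trans big; rewrite exprMn; apply: ler_wpM2l; first exact: exprn_ge0.
  by rewrite -[leLHS]expr1; apply: ler_weXn2l.
rewrite mulrAC; apply: ler_wpM2r; first exact: exprn_ge0.
by rewrite -exprMn; apply: lerXn2r; rewrite ?nnegrE ?mulr_ge0 ?ler0n.
Qed.

(** A labelled copy of the union of all boards lets Client win, and the density of this union is
    what the second moment bound needs. *)
Lemma Pr_waiter_wins_dense (R : realFieldType) (b : nat) (VH : finType) (eH : rel VH)
    (v : nat) (e : VH -> rel 'I_v) : (1 < v)%N -> simple_graph eH ->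
  (forall x, [/\ simple_graph (e x),
     forall S : {set 'I_v}, S != set0 -> (ep (e x) S + 2 <= 2 * #|S|)%N &
     cwin b (has_copy eH (component eH x) (e x)) set0 setT]) ->
  exists k : nat, forall (n : nat) (p L : R), 0 < p <= 1 -> 1 <= L -> (k < n)%N ->
    (L * (2 * k.+1)%N%:R ^+ v) ^+ v.-1 <= n%:R ^+ v * p ^+ v.-1 ->
    Pr p (fun E : {set epair n} => ~~ client_wins b eH setT (gadj E)) <= 2 ^+ k / L.
Proof.
move=> v1 sH boards.
have [M HM] := client_wins_boards sH (fun x => let: And3 _ _ w := boards x in w).
pose U : finType := (VH * 'I_M * 'I_v)%type.
pose eU : rel U := block_rel (fun k : VH * 'I_M => e k.1).
have sU : simple_graph eU.
  split=> [a c|a]; rewrite /eU /block_rel; last by have [[_ ->] _ _] := boards a.1.1; rewrite andbF.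
  by rewrite eq_sym; case: eqP => //= ->; have [[-> _] _ _] := boards a.1.1.
(* Each vertex of [U] gets a block of [n %/ #|U|.+1] nodes; the successor keeps the divisor
   positive. *)
exists #|U| => n p L p01 L1 kn big; have /andP[p0 p1] := p01.
have L0 : 0 < L by apply: lt_le_trans L1.
have s0 : (0 < n %/ #|U|.+1)%N by rewrite divn_gt0.
have sn : (#|U| * (n %/ #|U|.+1) <= n)%N.
  by apply: leq_trans (leq_trunc_div n #|U|.+1); rewrite mulnC leq_mul2l leqnSn orbT.
apply: le_trans (Pr_no_labelling sU sn p01 L0 s0 _).
  apply: Pr_sub; first by rewrite ltW.
  move=> E; apply: contraR; rewrite negb_forall => /existsP[x]; rewrite negbK => sub.
  apply: (HM _ _ (fun a => node sn a (x a))) => [a c /node_inj[]|a c eac] //.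
  exact: labelled_hom sub eac.
move=> A A0; apply: (density_power v1 p0 L1 s0).
- by move: A0; rewrite (ep_edges_in sU) muln_gt0.
- have := @block_rel_density _ _ _ A (fun k => let: And3 _ w _ := boards k.1 in w).
  by rewrite -/eU (ep_edges_in sU) mulnCA -mulnA leq_mul2l.
exact: floor_power v1 (ltW p0) (ltW L0) kn big.
Qed.

Lemma gnp_probE (n : nat) (p : R) (Q : pred {set epair n}) : gnp_prob p Q = Pr p Q.
Proof.
rewrite /gnp_prob /Pr; apply: eq_bigr => E _.
by rewrite /bern cardsT !RpowE.
Qed.

Lemma whp_Pr (Q : forall n : nat, pred {set epair n}) (p : nat -> R) : prob_bounds p ->
  (forall eps : R, 0 < eps -> exists N : nat, forall n, (N <= n)%N ->
     Pr (p n) (predC (Q n)) <= eps) -> whp Q p.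
Proof.
(* Convergence asks for a strict inequality and [H] gives a weak one, hence half of [eps]. *)
move=> pb H eps /RltP eps0; have [|N HN] := H (eps / 2); first by rewrite divr_gt0.
exists N => n /ssrnat.leP Nn; apply/RltP; rewrite RdistE gnp_probE Pr_compl.
have p01 : 0 <= p n <= 1 by have [/RleP -> /RleP ->] := pb n.
have := Pr_ge0 (predC (Q n)) p01; have := HN n Nn.
set P := Pr _ _ => le ge.
rewrite (_ : 1 - P - R1 = - P); last by change (1 - P - (1 : R) = - P); rewrite addrAC subrr sub0r.
by rewrite normrN ger0_norm // (le_lt_trans le) // ltr_pdivrMr // ltr_pMr // ltr1n.
Qed.

Lemma threshold_gt0 (v e n : nat) : 0 < threshold v e n.
Proof. by apply/RltP; apply: exp_pos. Qed.

Lemma INRE (n : nat) : INR n = n%:R.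
Proof. by elim: n => // n IH; rewrite S_INR IH RplusE -natr1. Qed.

(** Later estimates use the real exponent only through this identity and positivity. *)
Lemma threshold_power (v e n : nat) : (0 < e)%N -> (0 < n)%N ->
  n%:R ^+ v * threshold v e n ^+ e = 1.
Proof.
move=> e0 n0; have nR : Rlt R0 (INR n) by apply: lt_0_INR; apply/ssrnat.ltP.
have eR : INR e <> R0 by apply: not_0_INR; move: e0; case: (e).
have -> : threshold v e n ^+ e = Rinv (INR n ^+ v).
  rewrite -!RpowE -Rpower_pow; last exact: exp_pos.
  rewrite /threshold Rpower_mult -Rpower_pow // -Rpower_Ropp; congr Rpower.
  by rewrite /Rdiv Ropp_mult_distr_l_reverse Rmult_assoc Rinv_l // Rmult_1_r.
rewrite INRE RinvE mulfV // expf_neq0 // pnatr_eq0; lia.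
Qed.

Lemma threshold_mul_leq1 (v n : nat) : (1 < v)%N -> (0 < n)%N ->
  n%:R * threshold v v.-1 n <= 1.
Proof.
move=> v1 n0; have v'0 : (0 < v.-1)%N by lia.
have t0 : 0 <= threshold v v.-1 n by apply: ltW (threshold_gt0 _ _ _).
rewrite -(ler_pXn2r v'0) ?nnegrE ?mulr_ge0 ?ler0n // expr1n.
rewrite exprMn -[leRHS](threshold_power v v'0 n0); apply: ler_wpM2r.
  exact: exprn_ge0.
by apply: ler_weXn2l; rewrite ?ler1n // leq_pred.
Qed.

Lemma client_loses_whp (b : nat) (VH : finType) (eH : rel VH) x (v : nat) (p : nat -> R) :
  (forall (VT : finType) (eT : rel VT), is_tree eT ->
     client_wins b eH (component eH x) eT -> (v <= #|VT|)%N) ->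
  (1 < v)%N -> prob_bounds p -> little_o p (threshold v v.-1) ->
  whp (fun n (E : {set epair n}) => ~~ client_wins b eH setT (gadj E)) p.
Proof.
move=> minv v1 pb po; apply: whp_Pr => // eps eps0.
have v'0 : (0 < v.-1)%N by lia.
set c : R := (v * 2 ^ (v * v))%N%:R.
have c0 : 0 < c by rewrite ltr0n muln_gt0 expn_gt0; lia.
(* The second entry makes the final bound [c * d] at most [eps]; the first gives
   [d ^+ v.-1 <= d]. *)
pose d : R := Num.min 1 (eps / c).
have d0 : 0 < d by rewrite lt_min ltr01 divr_gt0.
have d1 : d <= 1 by rewrite ge_min lexx.
have [|N HN] := po d; first exact/RltP.
exists N.+1 => n Nn; have n0 : (0 < n)%N by apply: leq_trans Nn.
have /RleP := HN n (ltnW Nn); rewrite RmultE => pd.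
have p01 : 0 <= p n <= 1 by have [/RleP -> /RleP ->] := pb n.
have p0 : 0 <= p n by case/andP: p01.
have t0 := threshold_gt0 v v.-1 n.
apply: (@le_trans _ _ (Pr (p n) (fun E : {set epair n} => client_wins b eH setT (gadj E)))).
  by apply: Pr_sub => // E /=; rewrite negbK.
apply: (@le_trans _ _ (c * d)); last first.
  by rewrite mulrC -ler_pdivlMr // ge_min lexx orbT.
apply: (Pr_client_wins_sparse minv v1 p01); first by rewrite (ltW d0).
  apply: (@le_trans _ _ (d * (n%:R * threshold v v.-1 n))).
    by rewrite mulrCA; apply: ler_wpM2l pd; apply: ler0n.
  rewrite -[leRHS]mulr1; apply: ler_wpM2l; first exact: ltW.
  exact: threshold_mul_leq1.
apply: (@le_trans _ _ (d ^+ v.-1 * (n%:R ^+ v * threshold v v.-1 n ^+ v.-1))).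
  rewrite mulrCA -exprMn; apply: ler_wpM2l; first by rewrite exprn_ge0 ?ler0n.
  by apply: lerXn2r; rewrite ?nnegrE // mulr_ge0 // ltW.
rewrite threshold_power // mulr1 -[leRHS]expr1; apply: ler_wiXn2l => //.
exact: ltW.
Qed.

Lemma client_wins_whp (b : nat) (VH : finType) (eH : rel VH) (v : nat)
    (e : VH -> rel 'I_v) (p : nat -> R) : (1 < v)%N -> simple_graph eH ->
  (forall x, [/\ simple_graph (e x),
     forall S : {set 'I_v}, S != set0 -> (ep (e x) S + 2 <= 2 * #|S|)%N &
     cwin b (has_copy eH (component eH x) (e x)) set0 setT]) ->
  prob_bounds p -> little_omega p (threshold v v.-1) ->
  whp (fun n (E : {set epair n}) => client_wins b eH setT (gadj E)) p.
Proof.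
move=> v1 sH boards pb po; apply: whp_Pr => // eps eps0.
have v'0 : (0 < v.-1)%N by lia.
have [k Hk] := @Pr_waiter_wins_dense R b VH eH v e v1 sH boards.
pose L : R := Num.max 1 (2 ^+ k / eps).
have L1 : 1 <= L by rewrite le_max lexx.
have L0 : 0 < L by apply: lt_le_trans L1.
(* With [p] at least [m] times the threshold, [n ^ v * p ^ v.-1] is at least [m ^+ v.-1], the bound
   demanded by [Hk]. *)
pose m : R := L * (2 * k.+1)%N%:R ^+ v.
have m0 : 0 < m by rewrite mulr_gt0 // exprn_gt0 // ltr0n.
have [|N HN] := po m; first exact/RltP.
exists (N + k.+1)%N => n Nn; have kn : (k < n)%N by lia.
have n0 : (0 < n)%N by apply: leq_trans kn.
have /RleP : Rle (Rmult m (threshold v v.-1 n)) (p n) by apply: HN; lia.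
rewrite RmultE => mp; have [/RleP p0 /RleP p1] := pb n.
have t0 := threshold_gt0 v v.-1 n.
have p01 : 0 < p n <= 1 by rewrite p1 andbT; apply: lt_le_trans mp; rewrite mulr_gt0.
apply: le_trans (Hk n (p n) L p01 L1 kn _) _; last first.
  by rewrite ler_pdivrMr // mulrC -ler_pdivrMr // le_max lexx orbT.
rewrite -/m -[leLHS]mulr1 -[X in _ * X <= _](threshold_power v v'0 n0) mulrCA -exprMn.
apply: ler_wpM2l; first by rewrite exprn_ge0 ?ler0n.
by apply: lerXn2r; rewrite ?nnegrE // mulr_ge0 // ltW.
Qed.

End Asymptotics.

Theorem theorem10 :
  (* (1) trees *)
  (forall (b : nat) (VH : finType) (eH : rel VH),
      0 < b -> is_tree eH ->
      exists (VT : finType) (eT : rel VT), is_tree eT /\ client_wins b eH setT eT)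
  /\
  (* (2) forests in G(n,p) *)
  (forall (b : nat) (VH : finType) (eH : rel VH),
      0 < b -> is_forest eH -> (exists x y, eH x y) ->
      forall (VT : finType) (eT : rel VT),
        (* T_max: a minimum winning tree for some component ... *)
        (exists x : VH, min_winning_tree b eH (component eH x) eT) ->
        (* ... with the maximum number of vertices among these *)
        (forall (x : VH) (VT' : finType) (eT' : rel VT'),
            min_winning_tree b eH (component eH x) eT' -> #|VT'| <= #|VT|) ->
        forall p : nat -> R,
          prob_bounds p ->
          (little_omega p (threshold #|VT| (nedges eT)) ->
             whp (fun n E => client_wins b eH setT (gadj E)) p) /\
          (little_o p (threshold #|VT| (nedges eT)) ->
             whp (fun n E => ~~ client_wins b eH setT (gadj E)) p)).
Proof.
split=> [b VH eH _ tH|b VH eH _ fH [x0 [y0 exy]] VT eT [x [tT winT minT]] maxT p pb].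
  exact: grown_winning_tree tH.1 (tree_grown tH).
have small z := winning_tree_leq fH (maxT z).
have v1 : 1 < #|VT|.
  have [VT' [eT' [_ winT' le]]] := small x0.
  exact: leq_trans (winning_host_gt1 fH.1 exy winT') le.
have -> : nedges eT = #|VT|.-1 by rewrite -(nedges_tree tT).
(* Below the threshold the component behind [eT] alone defeats Client; above it every component
   needs a board, and maximality fits each one into [#|VT|] vertices. *)
split; last by apply: client_loses_whp minT v1 pb.
have boards z : exists e : rel 'I_#|VT|, [/\ simple_graph e,
    forall S : {set 'I_#|VT|}, S != set0 -> ep e S + 2 <= 2 * #|S| &
    cwin b (has_copy eH (component eH z) e) set0 setT].
  by have [VT' [eT' [tT' winT' le]]] := small z; apply: winning_board tT' winT' le.
have [e He] := fin_all_exists boards.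
exact: client_wins_whp v1 fH.1 He pb.
Qed.
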